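(* Fix an integer $d\geq 2$. The generating series $W=\sum_{n\geq0}w_{d,n}(t)x^n\in\left(\mathbb{Q}[t,t^{-1}]\right)[[x]]$ satisfies the algebraic equation $$W=1+tx\left(1+t^{-1}xW^d\right)^d.$$
   Context: For $n\geq0$ let $P_{(d-1)n}$ be a strictly convex polygon with $(d-1)n+2$ vertices and a marked boundary edge $e_*$. A $d$-dissection of it is a decomposition into $n$ non-overlapping convex polygons each having $d+1$ vertices, all among the vertices of $P_{(d-1)n}$. Its checkerboard colouring colours each of these polygons black or white such that the unique polygon containing $e_*$ is black and polygons sharing an edge have different colours; let $n_b,n_w$ be the numbers of black and white polygons. Define $w_{d,n}(t)=\sum t^{n_b-n_w}$, the sum over all $d$-dissections of $P_{(d-1)n}$, with $w_{d,0}=1$. *)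

(* Defs.v *)
From HB Require Import structures.
From mathcomp Require Import all_boot all_order all_algebra.
From mathcomp Require Import all_classical all_reals all_analysis.

Set Implicit Arguments.
Unset Strict Implicit.
Unset Printing Implicit Defensive.

Import Order.TTheory GRing.Theory Num.Theory.
Import numFieldNormedType.Exports.

Local Open Scope ring_scope.
Local Notation "x %:F" := (tofrac x).

(* The ring Q[t, 1/t] is realised as the subring of Q(t) of the fractions whose
   denominator is a power of t. *)

Definition laurent_pred : {pred {fraction {poly rat}}} :=
  fun f => `[< exists (p : {poly rat}) (n : nat), f = p%:F / 'X%:F ^+ n >].

Lemma fracX_neq0 : 'X%:F != 0 :> {fraction {poly rat}}.
Proof. by rewrite tofrac_eq0 polyX_eq0. Qed.

Lemma laurent_subring : subring_closed laurent_pred.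
Proof.
have X0 n : 'X%:F ^+ n != 0 :> {fraction {poly rat}}.
  by rewrite expf_neq0 // fracX_neq0.
split.
- by apply/asboolP; exists 1, 0%N; rewrite expr0 divr1 rmorph1.
- move=> _ _ /asboolP[p [m ->]] /asboolP[q [n ->]]; apply/asboolP.
  exists (p * 'X^n - q * 'X^m), (m + n)%N.
  rewrite rmorphB !rmorphM !rmorphXn exprD mulrBl invfM.
  congr (_ - _); first by rewrite [_^-1 * _]mulrC mulrA mulfK.
  by rewrite mulrA mulfK.
- move=> _ _ /asboolP[p [m ->]] /asboolP[q [n ->]]; apply/asboolP.
  exists (p * q), (m + n)%N.
  by rewrite rmorphM exprD invfM mulrACA.
Qed.

HB.instance Definition _ :=
  GRing.isSubringClosed.Build {fraction {poly rat}} laurent_pred laurent_subring.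

Record laurent := Laurent {
  laurent_val :> {fraction {poly rat}};
  _ : laurent_val \in laurent_pred }.

HB.instance Definition _ := [isSub for laurent_val].
HB.instance Definition _ := [Choice of laurent by <:].
HB.instance Definition _ := [SubChoice_isSubComNzRing of laurent by <:].

Definition laurent_unit : pred laurent :=
  fun f => (val f != 0) && ((val f)^-1 \in laurent_pred).

(* By [insubd], non-units are sent to themselves, as [unitRingType] demands. *)
Definition laurent_inv (f : laurent) : laurent := insubd f (val f)^-1.

Lemma laurent_mulVx : {in laurent_unit, left_inverse 1 laurent_inv *%R}.
Proof.
move=> f /andP[f0 fV]; apply: val_inj.
by rewrite rmorphM rmorph1 /= val_insubd fV mulVf.
Qed.

Lemma laurent_unitPl (f g : laurent) : g * f = 1 -> laurent_unit f.
Proof.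
move=> /(congr1 val); rewrite rmorphM rmorph1 /= => gf1.
have f0 : val f != 0.
  by apply/eqP => f0; move/eqP: gf1; rewrite f0 mulr0 eq_sym oner_eq0.
by rewrite /laurent_unit f0 -[(val f)^-1]mul1r -gf1 mulfK // (valP g).
Qed.

Lemma laurent_inv_out : {in [predC laurent_unit], laurent_inv =1 id}.
Proof.
move=> f; rewrite inE /= unfold_in /laurent_unit negb_and negbK => fN.
apply: val_inj; rewrite /laurent_inv val_insubd.
by case/orP: fN => [/eqP -> | /negPf ->] //; rewrite invr0 if_same.
Qed.

HB.instance Definition _ := GRing.ComNzRing_hasMulInverse.Build laurent
  laurent_mulVx laurent_unitPl laurent_inv_out.

Lemma laurentX_subproof : 'X%:F \in laurent_pred.
Proof. by apply/asboolP; exists 'X, 0%N; rewrite expr0 divr1. Qed.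

Definition laurentX : laurent := Laurent laurentX_subproof.

Lemma laurentX_unit : laurentX \is a GRing.unit.
Proof.
apply/andP; split; first exact: fracX_neq0.
by apply/asboolP; exists 1, 1%N; rewrite rmorph1 expr1 mul1r.
Qed.

Record fps (A : Type) := Fps { fcoef : nat -> A }.
Arguments Fps {A} fcoef.

Section FpsRing.
Variable A : comNzRingType.

HB.instance Definition _ := gen_eqMixin (fps A).
HB.instance Definition _ := gen_choiceMixin (fps A).

Lemma fpsP (f g : fps A) : fcoef f =1 fcoef g -> f = g.
Proof. by case: f g => [f] [g] /= /funext ->. Qed.

Definition fps0 : fps A := Fps (fun=> 0).
Definition fps_opp (f : fps A) := Fps (fun n => - fcoef f n).
Definition fps_add (f g : fps A) := Fps (fun n => fcoef f n + fcoef g n).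
Definition fps1 : fps A := Fps (fun n => (n == 0%N)%:R).
Definition fps_mul (f g : fps A) :=
  Fps (fun n => \sum_(i < n.+1) fcoef f i * fcoef g (n - i)).

Lemma fps_addA : associative fps_add.
Proof. by move=> f g h; apply: fpsP => n /=; rewrite addrA. Qed.
Lemma fps_addC : commutative fps_add.
Proof. by move=> f g; apply: fpsP => n /=; rewrite addrC. Qed.
Lemma fps_add0 : left_id fps0 fps_add.
Proof. by move=> f; apply: fpsP => n /=; rewrite add0r. Qed.
Lemma fps_addN : left_inverse fps0 fps_opp fps_add.
Proof. by move=> f; apply: fpsP => n /=; rewrite addNr. Qed.

HB.instance Definition _ :=
  GRing.isZmodule.Build (fps A) fps_addA fps_addC fps_add0 fps_addN.

Definition fps_trunc N (f : fps A) : {poly A} := \poly_(i < N) fcoef f i.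

Lemma fps_mul_trunc N n (f g : fps A) : (n < N)%N ->
  fcoef (fps_mul f g) n = (fps_trunc N f * fps_trunc N g)`_n.
Proof.
move=> nN; rewrite coefM; apply: eq_bigr => i _; rewrite !coef_poly.
by rewrite (leq_ltn_trans (leq_ord i) nN) (leq_ltn_trans (leq_subr i n) nN).
Qed.

Lemma fps_mulC : commutative fps_mul.
Proof.
by move=> f g; apply: fpsP => n; rewrite !(@fps_mul_trunc n.+1) // mulrC.
Qed.

Lemma fps_mulA : associative fps_mul.
Proof.
move=> f g h; apply: fpsP => n.
have [tf tg th] : [/\ forall i, (i <= n)%N -> (fps_trunc n.+1 f)`_i = fcoef f i,
    forall i, (i <= n)%N -> (fps_trunc n.+1 g)`_i = fcoef g i &
    forall i, (i <= n)%N -> (fps_trunc n.+1 h)`_i = fcoef h i].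
  by split=> i ni; rewrite coef_poly ltnS ni.
transitivity (fps_trunc n.+1 f * (fps_trunc n.+1 g * fps_trunc n.+1 h))`_n.
  rewrite coefM; apply: eq_bigr => i _; rewrite tf ?leq_ord //.
  by rewrite (@fps_mul_trunc n.+1) // ltnS leq_subr.
rewrite mulrA coefM; apply: eq_bigr => i _; rewrite th ?leq_subr //.
by rewrite (@fps_mul_trunc n.+1).
Qed.

Lemma fps_mul1 : left_id fps1 fps_mul.
Proof.
move=> f; apply: fpsP => n /=.
rewrite big_ord_recl /= mul1r subn0 big1 ?addr0 // => i _.
by rewrite mul0r.
Qed.

Lemma fps_mulDl : left_distributive fps_mul fps_add.
Proof.
move=> f g h; apply: fpsP => n /=; rewrite -big_split /=.
by apply: eq_bigr => i _; rewrite mulrDl.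
Qed.

Lemma fps1_neq0 : fps1 != 0.
Proof.
apply/eqP => /(congr1 (fun f => fcoef f 0%N)) /= /eqP.
by rewrite oner_eq0.
Qed.

HB.instance Definition _ := GRing.Zmodule_isComNzRing.Build (fps A)
  fps_mulA fps_mulC fps_mul1 fps_mulDl fps1_neq0.

Definition fpsC (a : A) : fps A := Fps (fun n => if n == 0%N then a else 0).
Definition fpsX : fps A := Fps (fun n => (n == 1%N)%:R).

End FpsRing.

Arguments fpsX {A}.

Section Polygon.
Variables (R : realType) (N : nat) (p : 'I_N -> 'rV[R]_2).

(* Twice the signed area of the triangle abc: positive iff a, b, c are in
   counterclockwise order. *)
Definition orient (a b c : 'rV[R]_2) : R :=
  (b 0 0 - a 0 0) * (c 0 1 - a 0 1) - (b 0 1 - a 0 1) * (c 0 0 - a 0 0).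

(* The points p 0, ..., p (N - 1) are the vertices of a strictly convex
   polygon, listed counterclockwise. *)
Definition strictly_convex :=
  forall i j k : 'I_N, (i < j < k)%N -> 0 < orient (p i) (p j) (p k).

(* When p is strictly convex, any set A of at least three indices gives a convex
   polygon [hull A] whose vertices are exactly the p i with i \in A; hence
   polygons with vertices among those of p are represented by sets of indices. *)
Definition hull (A : {set 'I_N}) : set 'rV[R]_2 :=
  [set q | exists w : 'I_N -> R,
     [/\ forall i, 0 <= w i, \sum_(i in A) w i = 1
       & q = \sum_(i in A) w i *: p i]].

Definition edges (A : {set 'I_N}) : {set {set 'I_N}} :=
  [set [set ij.1; ij.2] | ij : 'I_N * 'I_N &
     [&& ij.1 \in A, ij.2 \in A, ij.1 != ij.2 &
         [forall (k | k \in A :\: [set ij.1; ij.2]),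
            0 < orient (p ij.1) (p ij.2) (p k)]]].

Definition share_edge (A B : {set 'I_N}) : bool :=
  edges A :&: edges B != finset.set0.

Definition dissection (d n : nat) (D : {set {set 'I_N}}) : Prop :=
  [/\ #|D| = n,
      forall A, A \in D -> #|A| = d.+1,
      forall A B, A \in D -> B \in D -> A != B ->
        (hull A)° `&` (hull B)° = set0
    & \bigcup_(A in [set` D]) hull A = hull [set: 'I_N] ]%classic.

(* The marked edge joins the vertex e to the next one, [ordS e]. A colouring of
   D is given by its set B of black polygons. *)
Definition checkerboard (e : 'I_N) (D B : {set {set 'I_N}}) : bool :=
  [&& B \subset D,
      [forall A in D, ([set e; ordS e] \subset A) ==> (A \in B)] &
      [forall A in D, forall A' in D,
         (A != A') && share_edge A A' ==> ((A \in B) != (A' \in B))]].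

(* The black polygons of the checkerboard colouring of D, which exists and is
   unique when D is a dissection. *)
Definition blacks (e : 'I_N) (D : {set {set 'I_N}}) : {set {set 'I_N}} :=
  odflt finset.set0 [pick B | checkerboard e D B].

Definition dissection_weight (e : 'I_N) (D : {set {set 'I_N}}) : laurent :=
  let B := blacks e D in
  laurentX ^ (#|B|%:Z - #|D :\: B|%:Z).

End Polygon.

(* For n = 0 the polygon is a degenerate digon, and the value is 1 by convention. *)
Definition w_poly (R : realType) (d n : nat)
    (p : 'I_(d.-1 * n).+2 -> 'rV[R]_2) (e : 'I_(d.-1 * n).+2) : laurent :=
  if n == 0%N then 1
  else \sum_(D : {set {set 'I_(d.-1 * n).+2}} | `[< dissection p d n D >])
         dissection_weight p e D.

Arguments w_poly {R} d n p e.

(* Main.v *)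
Require Import Defs.
From HB Require Import structures.
From mathcomp Require Import all_boot all_order all_algebra.
From mathcomp Require Import all_classical all_reals all_analysis.
From mathcomp Require Import zify ring lra.
Import Order.TTheory GRing.Theory Num.Theory.
Import numFieldNormedType.Exports.
Local Open Scope ring_scope.

Set Implicit Arguments.
Unset Strict Implicit.

(** Cut a dissection along the black polygon containing the marked edge: each of
    the other [d] edges of that polygon carries a dissection whose root polygon
    is white, so that [W = 1 + t x W'^d], where [W'] is the series with the
    colours exchanged, [W' = 1 + t^-1 x W^d].

    Geometrically, two distinct [d+1]-gons inscribed in a strictly convex polygon
    have disjoint interiors iff no chord of one crosses a chord of the other. A
    noncrossing family of [d+1]-gons on [m] consecutive vertices has at most
    [(m - 2)/(d - 1)] members, so by its cardinality a dissection is an extremal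
    noncrossing family; an extremal family contains a polygon through the end
    vertices and is extremal on each edge of that polygon. Conversely, such a
    recursively built family covers the polygon, since a convex polygon is cut
    into two by a chord. *)

(** * Noncrossing families of polygons *)

(* [lia] case-splits on every boolean hypothesis, which is exponential here. *)
Ltac ranks := repeat match goal with
  | H : is_true (in_mem _ _) |- _ => clear H
  | H : is_true (~~ _) |- _ => clear H
  | H : is_true (subset _ _) |- _ => clear H
  | H : _ = _ :> bool |- _ => clear H end; lia.

Section Chains.
Import mathcomp.boot.fintype mathcomp.boot.finset.
Variables (V : finType) (r : V -> nat) (d : nat).
Implicit Types (a b c x y z : V) (A X Y : {set V}) (D B : {set {set V}}).

(** Dissections are modelled by the ordinal relation [chain] on a finite type [V] with a rank
    function [r], so convexity matters only when chains are compared with hulls. The rank rotates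
    the polygon until the marked edge joins the least vertex to the greatest. The polygon cut off by
    an edge keeps the type [V], with new end vertices; what has to be shown is that a chain sum
    depends only on the rank difference of its ends, which also makes the series independent of [p]
    and [e]. The set [B] travels with [D] because the colour of a piece depends on the colour [s] at
    the root: a piece attached to a polygon starts from the opposite colour. The series with a white
    root is therefore the same sum taken at the other value of [s]. *)

Definition itv a b : {set V} := [set x | (r a <= r x <= r b)%N].

(** Expresses that [X] lies in one gap of [A], without naming the two consecutive vertices that
    bound the gap. *)
Definition uncut A X := forall z, z \in A ->
  (forall x, x \in X -> (r x <= r z)%N) \/ (forall x, x \in X -> (r z <= r x)%N).

(* In [chain s k a b A D B], A = {c_0 < ... < c_k} with c_0 = a and c_k = b, D is
   a union of dissections of the polygons on the ranges [c_i, c_(i+1)], and B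
   consists of its black members, the polygons on the edges c_i c_(i+1) having
   colour s (black when s is true). For k = 1 this is a coloured dissection of
   the polygon on [a, b] with marked edge ab. *)
Inductive chain : bool -> nat -> V -> V ->
    {set V} -> {set {set V}} -> {set {set V}} -> Prop :=
| chain_edge s a b : r b = (r a).+1 ->
    chain s 1 a b [set a; b] finset.set0 finset.set0
| chain_root s a b A D B : chain (~~ s) d a b A D B ->
    chain s 1 a b [set a; b] (A |: D) (if s then A |: B else B)
| chain_cons s k a b c A D1 B1 D2 B2 :
    chain s 1 a c [set a; c] D1 B1 -> chain s k.+1 c b A D2 B2 ->
    chain s k.+2 a b (a |: A) (D1 :|: D2) (B1 :|: B2).

Lemma itv_rank a b x : x \in itv a b -> (r a <= r x)%N /\ (r x <= r b)%N.
Proof. by rewrite inE => /andP[]. Qed.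

Lemma chain_itv s k a b A D B : chain s k a b A D B ->
  [/\ (r a < r b)%N, a \in A, b \in A, A \subset itv a b & #|A| = k.+1].
Proof.
have pair x y : (r x < r y)%N ->
    [/\ (r x < r y)%N, x \in [set x; y], y \in [set x; y],
        [set x; y] \subset itv x y & #|[set x; y]| = 2].
  move=> xy; rewrite !inE !eqxx orbT /= cards2; split=> //.
    by apply/subsetP => z; rewrite !inE => /orP[]/eqP->; ranks.
  by case: eqVneq xy => // ->; ranks.
elim=> {s k a b A D B} [s a b ab|s a b A D B _ [ab _ _ _ _]
    |s k a b c A D1 B1 D2 B2 _ [ac _ _ _ _] _ [cb cA bA /subsetP sA cardA]].
- by apply: pair; ranks.
- exact: pair.
split; rewrite ?inE ?eqxx ?bA ?orbT //; first by ranks.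
- apply/subsetP => z; rewrite !inE => /orP[/eqP ->|/sA /itv_rank[]]; ranks.
- rewrite cardsU1 cardA; case: (boolP (a \in A)) => // /sA /itv_rank; ranks.
Qed.

Lemma chain_pieces s k a b A D B : chain s k a b A D B ->
  forall X, X \in D -> [/\ #|X| = d.+1, X \subset itv a b & uncut A X].
Proof.
have upair x y X : X \subset itv x y -> uncut [set x; y] X.
  move=> /subsetP sX z; rewrite !inE => /orP[]/eqP ->; [right|left];
    by move=> u /sX /itv_rank[].
elim=> {s k a b A D B} [s a b ab X|s a b A D B ch IH X
    |s k a b c A D1 B1 D2 B2 ch1 IH1 ch2 IH2 X]; first by rewrite inE.
- have [ab aA bA sA cA] := chain_itv ch.
  rewrite !inE => /orP[/eqP ->|XD]; first by split=> //; apply: upair.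
  by have [cX sX _] := IH X XD; split=> //; apply: upair.
- have [ac _ _ _ _] := chain_itv ch1.
  have [cb _ _ /subsetP sA _] := chain_itv ch2.
  rewrite inE => /orP[/IH1|/IH2] [cX /subsetP sX uX]; split=> //.
  + by apply/subsetP => x /sX /itv_rank; rewrite inE; ranks.
  + move=> z; rewrite !inE => /orP[/eqP ->|/sA /itv_rank[cz _]].
      by right=> x /sX /itv_rank[].
    by left=> x /sX /itv_rank; ranks.
  + by apply/subsetP => x /sX /itv_rank; rewrite inE; ranks.
  + move=> z; rewrite !inE => /orP[/eqP ->|]; last exact: uX.
    by right=> x /sX /itv_rank; ranks.
Qed.

Lemma chain_blacks_sub s k a b A D B : chain s k a b A D B -> B \subset D.
Proof.
elim=> {s k a b A D B} [s a b ab|s a b A D B ch IH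
    |s k a b c A D1 B1 D2 B2 ch1 IH1 ch2 IH2]; first exact: subxx.
- by case: ifP => _; [apply: setUS | apply: subset_trans IH (subsetUr _ _)].
- exact: setUSS.
Qed.

(* For x < y in X, this says that xy is an edge of the polygon X. *)
Definition chord_side X x y :=
  (forall z, z \in X -> ~~ (r x < r z < r y)%N) \/ X \subset itv x y.

(** Two vertices of [A] that also belong to a polygon in a gap of [A] must be the two ends of that
    gap, so they span an edge of both polygons. *)
Lemma uncut_chord_side A X x y : uncut A X -> (r x < r y)%N ->
  x \in A -> y \in A -> x \in X -> y \in X -> chord_side A x y /\ chord_side X x y.
Proof.
move=> uX xy xA yA xX yX; split.
  by left=> z /uX[/(_ y yX)|/(_ x xX)]; ranks.
right; apply/subsetP => z zX; rewrite inE.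
case: (uX x xA) => [/(_ y yX)|/(_ z zX) zx]; first by ranks.
case: (uX y yA) => [/(_ z zX) zy|/(_ x xX)]; by ranks.
Qed.

Definition outside a b : {set V} := [set x | (r x <= r a)%N || (r b <= r x)%N].

(** In convex position this puts [X] and [Y] on opposite closed sides of the line through [x] and
    [y]. The relation is not symmetric: [X] takes the side cut off by the range. *)
Definition chord_separated X Y := exists x y,
  [/\ (r x < r y)%N, X \subset itv x y & Y \subset outside x y].

(** Provides one chord that separates [X] from all of [A]. Keeping [x] in [A] serves the induction:
    a vertex prepended to the chain then ranks below [x], hence outside the chord. *)
Lemma chain_gap s k a b A D B : chain s k a b A D B ->
  forall X, X \in D -> exists2 x, x \in A &
    exists y, [/\ (r x < r y)%N, X \subset itv x y & A \subset outside x y].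
Proof.
have pair x y X : (r x < r y)%N -> X \subset itv x y ->
    exists2 u, u \in [set x; y] & exists v,
    [/\ (r u < r v)%N, X \subset itv u v & [set x; y] \subset outside u v].
  move=> xy sX; exists x; first by rewrite !inE eqxx.
  exists y; split=> //.
  by apply/subsetP => z; rewrite !inE => /orP[]/eqP ->; rewrite leqnn ?orbT.
elim=> {s k a b A D B} [s a b ab|s a b A D B ch IH
    |s k a b c A D1 B1 D2 B2 ch1 IH1 ch2 IH2] X; first by rewrite inE.
- have [ab aA bA sA _] := chain_itv ch.
  rewrite 2!inE => /orP[/eqP ->|XD]; first exact: pair.
  by apply: pair => //; have [] := chain_pieces ch XD.
- have [ac _ _ _ _] := chain_itv ch1.
  have [cb _ _ /subsetP sA _] := chain_itv ch2.
  rewrite inE => /orP[] XD.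
  + exists a; first by rewrite !inE eqxx.
    exists c; split=> //; first by have [] := chain_pieces ch1 XD.
    apply/subsetP => z; rewrite !inE => /orP[/eqP ->|/sA /itv_rank]; first by ranks.
    by ranks.
  + have [x xA [y [xy sX /subsetP oA]]] := IH2 X XD.
    exists x; first by rewrite !inE xA orbT.
    exists y; split=> //; apply/subsetP => z; rewrite 2!inE.
    case/orP=> [/eqP -> {z}|/oA //]; rewrite inE.
    by have := itv_rank (sA x xA); ranks.
Qed.

Lemma chain_chord_separated s k a b A D B : chain s k a b A D B ->
  forall X Y, X \in D -> Y \in D -> X != Y -> chord_separated X Y \/ chord_separated Y X.
Proof.
elim=> {s k a b A D B} [s a b ab|s a b A D B ch IH
    |s k a b c A D1 B1 D2 B2 ch1 IH1 ch2 IH2] X Y; first by rewrite inE.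
- have gap Z : Z \in D -> chord_separated Z A.
    by move=> /(chain_gap ch)[x _ [y xy]]; exists x, y.
  rewrite 2!inE => /orP[/eqP ->|XD]; rewrite 2!inE => /orP[/eqP ->|YD] XY.
  + by rewrite eqxx in XY.
  + by right; apply: gap.
  + by left; apply: gap.
  + exact: IH.
- have [ac _ _ _ _] := chain_itv ch1.
  have sep Z1 Z2 : Z1 \in D1 -> Z2 \in D2 -> chord_separated Z1 Z2.
    move=> /(chain_pieces ch1)[_ s1 _] /(chain_pieces ch2)[_ /subsetP s2 _].
    exists a, c; split=> //; apply/subsetP => z /s2 /itv_rank[cz _].
    by rewrite inE cz orbT.
  rewrite !inE => /orP[] XD /orP[] YD XY.
  + exact: IH1.
  + by left; apply: sep.
  + by right; apply: sep.
  + exact: IH2.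
Qed.

(** The two ranges have only the vertex [c] in common; so the families over different edges of a
    chain are disjoint. *)
Lemma big_polygon_itv_meet X a b c : injective r -> (2 < #|X|)%N ->
  X \subset itv a c -> X \subset itv c b -> False.
Proof.
move=> r_inj X3 /subsetP Xac /subsetP Xcb.
suff : X \subset [set c].
  by move/subset_leq_card; rewrite cards1; ranks.
apply/subsetP => x xX; rewrite inE; apply/eqP/r_inj.
by have [] := itv_rank (Xac x xX); have [] := itv_rank (Xcb x xX); ranks.
Qed.

End Chains.

(** * Counting, colouring and extremality of chains *)

Section ChainCombinatorics.
Import mathcomp.boot.fintype mathcomp.boot.finset.
Variables (V : finType) (r : V -> nat) (d : nat).
Hypothesis r_inj : injective r.
Hypothesis r_onto : forall b m, (m <= r b)%N -> exists y, r y = m.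
Hypothesis d_ge2 : (2 <= d)%N.
Implicit Types (a b c x y z : V) (A X Y : {set V}) (D B : {set {set V}}).
Local Notation itv := (itv r).
Local Notation uncut := (uncut r).
Local Notation chain := (chain r d).
Local Notation chord_side := (chord_side r).

Lemma chain_mid s a b A D B : chain s d a b A D B ->
  exists2 z, z \in A & (r a < r z < r b)%N.
Proof.
move=> /chain_itv[ab aA bA /subsetP sA cA].
have : (0 < #|A :\ a :\ b|)%N.
  have := cardsD1 a A; have := cardsD1 b (A :\ a); rewrite aA cA !inE bA andbT.
  by case: eqVneq => /=; ranks.
rewrite card_gt0 => /set0Pn[z]; rewrite !inE => /and3P[zb za zA].
exists z => //; have := itv_rank (sA z zA).
have : r z <> r a by move/r_inj/eqP; rewrite (negPf za).
have : r z <> r b by move/r_inj/eqP; rewrite (negPf zb).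
ranks.
Qed.

Lemma chain_root_notin s a b A D B : chain s d a b A D B -> A \notin D.
Proof.
move=> ch; apply/negP => /(chain_pieces ch)[_ _ uA].
have [z zA abz] := chain_mid ch.
have [_ aA bA _ _] := chain_itv ch.
by case: (uA z zA) => [/(_ b bA)|/(_ a aA)]; ranks.
Qed.

Lemma chain_cons_disjoint s k a b c A1 A D1 B1 D2 B2 X :
  chain s 1 a c A1 D1 B1 -> chain s k.+1 c b A D2 B2 ->
  X \in D1 -> X \in D2 -> False.
Proof.
move=> ch1 ch2 /(chain_pieces ch1)[cX X1 _].
move=> /(chain_pieces ch2)[_ X2 _].
by apply: (big_polygon_itv_meet r_inj _ X1 X2); ranks.
Qed.

(** A polygon placed over [d] edges leaves a single edge in their place: [k] drops by [d - 1] when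
    [D] gains one member, and the length is unchanged. *)
Lemma chain_card s k a b A D B : chain s k a b A D B ->
  (d.-1 * #|D| + k = r b - r a)%N.
Proof.
elim=> {s k a b A D B} [s a b ab|s a b A D B ch IH
    |s k a b c A D1 B1 D2 B2 ch1 IH1 ch2 IH2]; first by rewrite cards0; ranks.
- rewrite cardsU1 (chain_root_notin ch) /=.
  by rewrite mulnDr muln1; move: IH; set m := (d.-1 * _)%N; ranks.
- have -> : #|D1 :|: D2| = (#|D1| + #|D2|)%N.
    rewrite cardsU (_ : D1 :&: D2 = finset.set0) ?cards0 ?subn0 //.
    apply/setP => X; rewrite !inE; apply/negP => /andP[X1 X2].
    exact: chain_cons_disjoint ch1 ch2 X1 X2.
  have [] := chain_itv ch1; have [] := chain_itv ch2.
  nia.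
Qed.

Lemma chain_cons_colour s k a b c A1 A D1 B1 D2 B2 :
  chain s 1 a c A1 D1 B1 -> chain s k.+1 c b A D2 B2 ->
  {in D1, forall X, (X \in B1 :|: B2) = (X \in B1)} /\
  {in D2, forall X, (X \in B1 :|: B2) = (X \in B2)}.
Proof.
move=> ch1 ch2; split=> X XD; rewrite inE.
- rewrite orbC; case: (boolP (X \in B2)) => // XB.
  have XD2 := subsetP (chain_blacks_sub ch2) X XB.
  by case: (chain_cons_disjoint ch1 ch2 XD XD2).
- case: (boolP (X \in B1)) => // XB.
  have XD1 := subsetP (chain_blacks_sub ch1) X XB.
  by case: (chain_cons_disjoint ch1 ch2 XD1 XD).
Qed.

(** Two vertices in common with [A] force [X] to be the polygon attached directly to an edge of [A];
    deeper pieces are kept away by the vertices of the polygon that carries them. *)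
Lemma chain_colour_root s k a b A D B : chain s k a b A D B ->
  forall X x y, X \in D -> x != y -> x \in X -> y \in X -> x \in A -> y \in A ->
  (X \in B) = s.
Proof.
elim=> {s k a b A D B} [s a b ab|s a b A D B ch IH
    |s k a b c A D1 B1 D2 B2 ch1 IH1 ch2 IH2] X x y; first by rewrite inE.
- have AD := chain_root_notin ch.
  have AB : A \notin B.
    by apply: contra AD => /(subsetP (chain_blacks_sub ch)).
  rewrite 2!inE => /orP[/eqP ->|XD] xy xX yX xab yab.
    by case: s {ch IH} => /=; rewrite ?inE ?eqxx ?(negPf AB).
  have [aX bX] : a \in X /\ b \in X.
    move: xab yab xy xX yX.
    by rewrite !inE => /orP[]/eqP -> /orP[]/eqP ->; rewrite ?eqxx.
  have [_ _ uX] := chain_pieces ch XD.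
  have [z zA abz] := chain_mid ch.
  by case: (uX z zA) => [/(_ b bX)|/(_ a aX)]; ranks.
- have [cb cA _ /subsetP sA _] := chain_itv ch2.
  have [ac _ _ _ _] := chain_itv ch1.
  have [c1 c2] := chain_cons_colour ch1 ch2.
  rewrite inE => /orP[] XD xy xX yX xA yA.
  + have [_ /subsetP sX _] := chain_pieces ch1 XD.
    have toac z : z \in X -> z \in a |: A -> z \in [set a; c].
      move=> zX; rewrite !inE => /orP[->//|zA]; apply/orP; right.
      apply/eqP/r_inj.
      by have := itv_rank (sX z zX); have := itv_rank (sA z zA); ranks.
    by rewrite c1 // (IH1 X x y) ?toac.
  + have [_ /subsetP sX _] := chain_pieces ch2 XD.
    have toA z : z \in X -> z \in a |: A -> z \in A.
      move=> zX; rewrite !inE => /orP[/eqP za|//].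
      by have := itv_rank (sX z zX); rewrite za; ranks.
    by rewrite c2 // (IH2 X x y) ?toA.
Qed.

(** Asking for two common vertices instead of a common edge avoids geometry; between members of a
    chain the two amount to the same. *)
Lemma chain_colour_adjacent s k a b A D B : chain s k a b A D B ->
  forall X Y x y, X \in D -> Y \in D -> X != Y -> x != y ->
  x \in X -> y \in X -> x \in Y -> y \in Y -> (X \in B) != (Y \in B).
Proof.
elim=> {s k a b A D B} [s a b ab|s a b A D B ch IH
    |s k a b c A D1 B1 D2 B2 ch1 IH1 ch2 IH2] X Y x y; first by rewrite inE.
- have AD := chain_root_notin ch.
  have AB : A \notin B by apply: contra AD => /(subsetP (chain_blacks_sub ch)).
  have newB Z : (Z \in (if s then A |: B else B)) = (s && (Z == A)) || (Z \in B).
    by case: (s); rewrite ?inE.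
  have step Z : Z \in D -> x != y -> x \in A -> y \in A -> x \in Z -> y \in Z ->
      (A \in (if s then A |: B else B)) != (Z \in (if s then A |: B else B)).
    move=> ZD xy xA yA xZ yZ; rewrite !newB eqxx (negPf AB) orbF andbT.
    rewrite (chain_colour_root ch ZD xy xZ yZ xA yA).
    have ZA : Z != A by apply: contraNneq AD => <-.
    by rewrite (negPf ZA) andbF; case: (s).
  rewrite 2!inE => /orP[/eqP ->|XD]; rewrite 2!inE => /orP[/eqP ->|YD].
  + by rewrite eqxx.
  + by move=> _ xy xA yA xY yY; apply: step.
  + by move=> _ xy xX yX xA yA; rewrite eq_sym; apply: step.
  + move=> XY xy xX yX xY yY; rewrite !newB.
    have XA : X != A by apply: contraNneq AD => <-.
    have YA : Y != A by apply: contraNneq AD => <-.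
    by rewrite (negPf XA) (negPf YA) andbF; apply: IH xX yX xY yY.
- have [c1 c2] := chain_cons_colour ch1 ch2.
  have meet Z1 Z2 : Z1 \in D1 -> Z2 \in D2 -> x != y ->
      x \in Z1 -> y \in Z1 -> x \in Z2 -> y \in Z2 -> False.
    move=> ZD1 ZD2 xy x1 y1 x2 y2.
    have [_ /subsetP s1 _] := chain_pieces ch1 ZD1.
    have [_ /subsetP s2 _] := chain_pieces ch2 ZD2.
    move/eqP: xy; apply; apply: r_inj.
    have := itv_rank (s1 x x1); have := itv_rank (s1 y y1).
    by have := itv_rank (s2 x x2); have := itv_rank (s2 y y2); ranks.
  rewrite 2!inE => /orP[] XD /orP[] YD XY xy xX yX xY yY.
  + by rewrite !c1 //; apply: IH1 xX yX xY yY.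
  + by case: (meet X Y).
  + by case: (meet Y X).
  + by rewrite !c2 //; apply: IH2 xX yX xY yY.
Qed.

(** Of the competitor [C] only the checkerboard rules are known, so alternation is assumed across
    common edges alone, expressed by [chord_side]. By [uncut_chord_side] the root polygon and a
    polygon attached to it meet in such an edge, which forces the colours level by level. *)
Lemma chain_colour_unique s k a b A D B : chain s k a b A D B ->
  forall C : {set {set V}},
  (forall X x y, X \in D -> x != y -> x \in X -> y \in X -> x \in A -> y \in A ->
     (X \in C) = s) ->
  (forall X Y x y, X \in D -> Y \in D -> X != Y -> (r x < r y)%N ->
     x \in X -> y \in X -> x \in Y -> y \in Y ->
     chord_side X x y -> chord_side Y x y -> (X \in C) != (Y \in C)) ->
  {in D, forall X, (X \in C) = (X \in B)}.
Proof.
elim=> {s k a b A D B} [s a b ab|s a b A D B ch IH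
    |s k a b c A D1 B1 D2 B2 ch1 IH1 ch2 IH2] C rootC adjC X; first by rewrite inE.
- have AD := chain_root_notin ch.
  have AB : A \notin B by apply: contra AD => /(subsetP (chain_blacks_sub ch)).
  have [ab aA bA _ _] := chain_itv ch.
  have ab' : a != b by apply: contraTneq ab => ->; rewrite ltnn.
  have AC : (A \in C) = s.
    by apply: (rootC A a b); rewrite ?inE ?eqxx ?orbT.
  rewrite 2!inE => /orP[/eqP ->|XD].
    by rewrite AC; case: (s); rewrite ?inE ?eqxx ?(negPf AB).
  have XA : X != A by apply: contraNneq AD => <-.
  have -> : (X \in (if s then A |: B else B)) = (X \in B).
    by case: (s); rewrite ?inE ?(negPf XA).
  apply: IH => // [Y x y YD xy xY yY xA yA|Y Z x y YD ZD].
  + have YA : Y != A by apply: contraNneq AD => <-.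
    have [_ _ uY] := chain_pieces ch YD.
    have : (A \in C) != (Y \in C).
      have [xy'|yx|/r_inj xy'] := ltngtP (r x) (r y); last by rewrite xy' eqxx in xy.
      * have [sA sY] := uncut_chord_side uY xy' xA yA xY yY.
        by apply: (adjC _ _ x y); rewrite ?inE ?eqxx ?YD ?orbT // eq_sym.
      * have [sA sY] := uncut_chord_side uY yx yA xA yY xY.
        by apply: (adjC _ _ y x); rewrite ?inE ?eqxx ?YD ?orbT // eq_sym.
    by rewrite AC; case: (s); case: (Y \in C).
  + by apply: adjC; rewrite inE ?YD ?ZD orbT.
- have [c1 c2] := chain_cons_colour ch1 ch2.
  have [cb cA _ _ _] := chain_itv ch2.
  rewrite inE => /orP[] XD.
  + rewrite c1 //; apply: IH1 => // [Y x y YD xy xY yY xA yA|Y Z x y YD ZD].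
      apply: (rootC Y x y); rewrite ?inE ?YD //.
        by move: xA; rewrite !inE => /orP[]/eqP ->; rewrite ?eqxx ?cA ?orbT.
      by move: yA; rewrite !inE => /orP[]/eqP ->; rewrite ?eqxx ?cA ?orbT.
    by apply: adjC; rewrite inE ?YD ?ZD.
  + rewrite c2 //; apply: IH2 => // [Y x y YD xy xY yY xA yA|Y Z x y YD ZD].
      by apply: (rootC Y x y); rewrite ?inE ?YD ?xA ?yA ?orbT.
    by apply: adjC; rewrite inE ?YD ?ZD orbT.
Qed.

(** One interleaving pattern suffices: exchanging [X] and [Y] gives the other. *)
Definition noncrossing D := forall X Y x1 y1 x2 y2, X \in D -> Y \in D -> X != Y ->
  x1 \in X -> x2 \in X -> y1 \in Y -> y2 \in Y ->
  ~~ [&& r x1 < r y1, r y1 < r x2 & r x2 < r y2]%N.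

Definition polygon_family D :=
  (forall X, X \in D -> #|X| = d.+1) /\ noncrossing D.

Lemma polygon_familyS D D' : D' \subset D -> polygon_family D -> polygon_family D'.
Proof.
move=> /subsetP sD [cD nD]; split=> [X /sD|X Y x1 y1 x2 y2 /sD XD /sD YD]; first exact: cD.
exact: nD.
Qed.

(** Bounding the length by [m] makes this an induction hypothesis that [tight_chain] can apply to
    each edge of a polygon. The root colour [s] is free, since a bare family carries no
    colouring. *)
Definition tight m := forall a b D, (r a < r b)%N -> (r b - r a <= m)%N ->
  polygon_family D -> (forall X, X \in D -> X \subset itv a b) ->
  (d.-1 * #|D| + 1 <= r b - r a)%N /\
  ((d.-1 * #|D| + 1 = r b - r a)%N ->
    forall s, exists B, chain s 1 a b [set a; b] D B).

Lemma cardsU_split D a b c : (forall X, X \in D -> #|X| = d.+1) ->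
  (forall X, X \in D -> X \subset itv a c \/ X \subset itv c b) ->
  exists D1 D2, [/\ D = D1 :|: D2, #|D| = (#|D1| + #|D2|)%N,
    forall X, X \in D1 -> X \subset itv a c & forall X, X \in D2 -> X \subset itv c b].
Proof.
move=> cD sD; exists [set X : {set V} in D | X \subset itv a c],
  [set X : {set V} in D | ~~ (X \subset itv a c)].
split=> [|| X | X].
- by apply/setP => X; rewrite !inE -andb_orr orbN andbT.
- by rewrite -(cardsID [set X : {set V} | X \subset itv a c] D); congr addn;
    apply: eq_card => X; rewrite !inE // andbC.
- by rewrite inE => /andP[].
- by rewrite inE => /andP[/sD[->|]].
Qed.

(** The bounds for the edges of [A] add up, so equality in the total forces equality on every edge.
    The term [(0 < k)] records that with at least two edges each one is strictly shorter than the
    whole range, so [tight m] reaches lengths up to [m + 1]. *)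
Lemma tight_chain m : tight m -> forall k A a b D, #|A| = k.+2 ->
  A \subset itv a b -> a \in A -> b \in A -> (r a < r b)%N ->
  (r b - r a <= m + (0 < k))%N -> polygon_family D ->
  (forall X, X \in D -> X \subset itv a b /\ uncut A X) ->
  (d.-1 * #|D| + k.+1 <= r b - r a)%N /\
  ((d.-1 * #|D| + k.+1 = r b - r a)%N -> forall s, exists B, chain s k.+1 a b A D B).
Proof.
move=> Pm; elim=> [|k IH] A a b D cA sA aA bA ab abm famD sD.
  have -> : A = [set a; b].
    apply/esym/eqP; rewrite eqEcard cA cards2 subUset !sub1set aA bA /=.
    by case: eqVneq ab => // ->; rewrite ltnn.
  by apply: Pm => //; [ranks | move=> X /sD[]].
have neq x y : x != y -> r x <> r y by move=> /eqP xy /r_inj.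
have [z] : exists z, z \in A :\ a :\ b.
  apply/card_gt0P.
  have := cardsD1 a A; have := cardsD1 b (A :\ a); rewrite aA cA !inE bA andbT.
  by case: eqVneq => /=; ranks.
rewrite !inE => /and3P[/neq zb za zA].
have zAa : z \in A :\ a by rewrite !inE za.
(* [c] is the vertex of [A] following [a]; the vertex [z] shows that it comes before [b]. *)
have [c cAa cmin] : exists2 c, c \in A :\ a & forall x, x \in A :\ a -> (r c <= r x)%N.
  by case: (arg_minnP r zAa) => c; exists c.
have := cAa; rewrite !inE => /andP[/neq ca cA'].
have cz := cmin z zAa.
have cab := itv_rank (subsetP sA c cA'); have zab := itv_rank (subsetP sA z zA).
have ac : (r a < r c)%N by ranks.
have cb : (r c < r b)%N by ranks.
have splitD X : X \in D -> X \subset itv a c \/ X \subset itv c b.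
  move=> XD; have [/subsetP sX uX] := sD X XD.
  case: (uX c cA') => h; [left|right]; apply/subsetP => x xX; rewrite inE;
    by have := h x xX; have := itv_rank (sX x xX); ranks.
have [D1 [D2 [eD cD s1 s2]]] := cardsU_split (proj1 famD) splitD.
have sD1 : D1 \subset D by rewrite eD subsetUl.
have sD2 : D2 \subset D by rewrite eD subsetUr.
have [|//|le1 eq1] := Pm a c D1 ac _ (polygon_familyS sD1 famD); first by ranks.
have bAa : b \in A :\ a.
  by rewrite !inE bA andbT; case: eqVneq ab => // ->; rewrite ltnn.
have [|||X XD|le2 eq2] := IH (A :\ a) c b D2 _ _ cAa bAa cb _ (polygon_familyS sD2 famD).
- by have := cardsD1 a A; rewrite aA cA; ranks.
- apply/subsetP => x xA; rewrite inE cmin //=.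
  by move: xA; rewrite !inE => /andP[_ /(subsetP sA) /itv_rank[]].
- by ranks.
- split; first exact: s2.
  move=> x; rewrite !inE => /andP[_ xA].
  have [_] := sD X (subsetP sD2 X XD); exact.
rewrite cD mulnDr; split; first by ranks.
move=> eq s.
have [|B1 ch1] := eq1 _ s; first by ranks.
have [|B2 ch2] := eq2 _ s; first by ranks.
exists (B1 :|: B2); rewrite eD -(setD1K aA).
exact: chain_cons ch1 ch2.
Qed.

(** Let [x] be a vertex of [X] outside [A]. If some [z] in [A] separated [x] from another vertex [y]
    of [X], the chord [xy] would cross [az] or [zb]. *)
Lemma polygon_uncut A X a b : (forall x1 y1 x2 y2,
    x1 \in A -> x2 \in A -> y1 \in X -> y2 \in X ->
    ~~ [&& r x1 < r y1, r y1 < r x2 & r x2 < r y2]%N /\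
    ~~ [&& r y1 < r x1, r x1 < r y2 & r y2 < r x2]%N) ->
  a \in A -> b \in A -> X \subset itv a b -> ~~ (X \subset A) -> uncut A X.
Proof.
move=> ncr aA bA /subsetP sX /subsetPn[x xX xA] z zA.
have neq y : y \in A -> r x <> r y by move=> yA /r_inj xy; rewrite xy yA in xA.
have xza := neq a aA; have xzb := neq b bA; have xz := neq z zA.
have := itv_rank (sX x xX) => -[ax xb].
have [xlz|zlx] := ltnP (r x) (r z).
- left=> y yX; rewrite leqNgt; apply/negP => zy.
  have [/negP + _] := ncr a x z y aA zA xX yX; apply.
  by apply/and3P; split; ranks.
- right=> y yX; rewrite leqNgt; apply/negP => yz.
  have [_ /negP +] := ncr z y b x zA bA yX xX; apply.
  by apply/and3P; split; ranks.
Qed.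

(* A family with a polygon on the chord [a, b] is cut along the other edges of
   that polygon. Otherwise cutting at the farthest vertex c seen from a inside a
   polygon of the family loses one unit. *)
Lemma polygon_family_tight m : tight m.
Proof.
elim: m => [|m Pm] a b D ab abm famD sD; first by ranks.
have [cD nD] := famD.
have neq x y : x != y -> r x <> r y by move=> /eqP xy /r_inj.
have [rb|/eqP rb] := eqVneq (r b) (r a).+1.
  have -> : D = finset.set0.
    apply/setP => X; rewrite inE; apply/negP => XD.
    have : (#|X| <= #|[set a; b]|)%N.
      apply/subset_leq_card/subsetP => x /(subsetP (sD X XD)) /itv_rank xab.
      rewrite !inE; case: eqVneq => //= /neq xa; apply/eqP/r_inj; ranks.
    by rewrite cD // cards2; case: (_ != _) => /=; ranks.
  rewrite cards0 muln0; split; first by ranks.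
  by move=> _ s; exists finset.set0; apply: chain_edge.
have [/existsP[A /and3P[AD aA bA]]|noA] :=
    boolP [exists A : {set V}, [&& A \in D, a \in A & b \in A]].
  have cA := cD A AD.
  have famD' := polygon_familyS (subD1set D A) famD.
  have [||X|le eq] := tight_chain Pm (k := d.-1) (A := A) (D := D :\ A)
    _ (sD A AD) aA bA ab _ famD'.
  - by ranks.
  - by ranks.
  - rewrite !inE => /andP[XA XD]; split; first exact: sD.
    apply: (polygon_uncut _ aA bA (sD X XD)).
      move=> x1 y1 x2 y2 x1A x2A y1X y2X; split.
        by apply: (nD A X) => //; rewrite eq_sym.
      exact: (nD X A).
    by apply: contra XA => sXA; rewrite eqEcard sXA cA cD // leqnn.
  have cDA := cardsD1 A D; rewrite AD /= in cDA.
  have dd : (d.-1.+1 = d) by ranks.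
  rewrite cDA mulnDr muln1; rewrite dd in le eq.
  move: (d.-1 * _)%N le eq => q le eq; split; first by ranks.
  move=> tot s; have [|B ch] := eq _ (~~ s); first by ranks.
  by exists (if s then A |: B else B); rewrite -(setD1K AD); apply: chain_root.
(* The successor of [a] is included so that [S] is nonempty and [c] lies above [a] even when no
   member contains [a]. *)
pose S := [set y | (r y == (r a).+1) ||
  [exists X : {set V}, [&& X \in D, a \in X & y \in X]]].
have [a1 ra1] : exists y, r y = (r a).+1 by apply: (@r_onto b); ranks.
have a1S : a1 \in S by rewrite inE ra1 eqxx.
have [c cS cmax] : exists2 c, c \in S & forall x, x \in S -> (r x <= r c)%N.
  by case: (arg_maxnP r a1S) => c; exists c.
have ac : (r a < r c)%N by have := cmax a1 a1S; ranks.
have cb : (r c < r b)%N.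
  move: cS; rewrite inE => /orP[/eqP ->|/existsP[X /and3P[XD aX cX]]]; first by ranks.
  have := itv_rank (subsetP (sD X XD) c cX).
  case: (eqVneq c b) => [cb|/neq]; last by ranks.
  by case/negP: noA; apply/existsP; exists X; rewrite XD aX -cb.
have splitD X : X \in D -> X \subset itv a c \/ X \subset itv c b.
  move=> XD; have := sD X XD => /subsetP sX.
  case: (boolP (a \in X)) => aX.
    left; apply/subsetP => x xX; rewrite inE.
    have := itv_rank (sX x xX); suff : (r x <= r c)%N by ranks.
    apply: cmax; rewrite inE; apply/orP; right; apply/existsP; exists X.
    by rewrite XD aX xX.
  have Xa x : x \in X -> (r a < r x)%N.
    move=> xX; have := itv_rank (sX x xX); case: (eqVneq x a) => [xa|/neq]; last by ranks.
    by rewrite -xa xX in aX.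
  case: (boolP (X \subset itv a c)) => [|/subsetPn[x2 x2X]]; first by left.
  rewrite inE => x2c; right; apply/subsetP => x1 x1X; rewrite inE.
  have := (itv_rank (sX x1 x1X), itv_rank (sX x2 x2X), Xa x1 x1X, Xa x2 x2X).
  move=> [[[i1 i2] a1x] a2x]; rewrite (proj2 i1) andbT leqNgt; apply/negP => x1c.
  have cx2 : (r c < r x2)%N by move: x2c i2 a2x; clear; lia.
  (* If [c] is the successor of [a], there is no room for [x1] between them. Otherwise [c] comes
     from a member [Y] through [a], and [x1 x2] would cross its chord [ac]. *)
  move: cS; rewrite inE => /orP[/eqP|/existsP[Y /and3P[YD aY cY]]]; first by ranks.
  have YX : Y != X by apply: contraNneq aX => <-.
  by have /and3P[] := nD Y X a x1 c x2 YD XD YX aY cY x1X x2X.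
have [D1 [D2 [eD cDD s1 s2]]] := cardsU_split cD splitD.
have sD1 : D1 \subset D by rewrite eD subsetUl.
have sD2 : D2 \subset D by rewrite eD subsetUr.
have [|//|le1 _] := Pm a c D1 ac _ (polygon_familyS sD1 famD); first by ranks.
have [|//|le2 _] := Pm c b D2 cb _ (polygon_familyS sD2 famD); first by ranks.
by rewrite cDD mulnDr; split; ranks.
Qed.

End ChainCombinatorics.

(** * Sums over dissections *)

Section ChainSums.
Import mathcomp.boot.fintype mathcomp.boot.finset.
Variables (V : finType) (r : V -> nat) (d : nat).
Hypothesis r_inj : injective r.
Hypothesis d_ge2 : (2 <= d)%N.
Variables (K : comNzRingType) (tau : bool -> K).
Implicit Types (a b c x y z : V) (A X Y : {set V}) (D B : {set {set V}}).

Definition colour_weight D B : K := \prod_(X in D) tau (X \in B).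

Definition coloured_chain : Type := ({set V} * {set {set V}} * {set {set V}})%type.

Definition chains s k a b : {set coloured_chain} :=
  [set T | `[< chain r d s k a b T.1.1 T.1.2 T.2 >]].

Definition chain_sum s k a b : K :=
  \sum_(T in chains s k a b) colour_weight T.1.2 T.2.

Lemma chainsP s k a b T :
  reflect (chain r d s k a b T.1.1 T.1.2 T.2) (T \in chains s k a b).
Proof. by rewrite inE; apply: asboolP. Qed.

Lemma chain1_inv s a b A D B : chain r d s 1 a b A D B -> A = [set a; b] /\
  ([/\ r b = (r a).+1, D = finset.set0 & B = finset.set0] \/
   exists A' D' B', [/\ chain r d (~~ s) d a b A' D' B', D = A' |: D' &
     B = if s then A' |: B' else B']).
Proof.
move eqk : 1%N => k ch; case: ch eqk => // {s k a b A D B}.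
- by move=> s a b ab _; split=> //; left.
- by move=> s a b A D B ch _; split=> //; right; exists A, D, B.
Qed.

Lemma chain_cons_inv s k a b A D B : chain r d s k.+2 a b A D B ->
  exists c A' D1 B1 D2 B2, [/\ chain r d s 1 a c [set a; c] D1 B1,
    chain r d s k.+1 c b A' D2 B2, A = a |: A', D = D1 :|: D2 & B = B1 :|: B2].
Proof.
move eqk : k.+2 => k' ch; case: ch eqk => // {s k' a b A D B}.
move=> s k' a b c A D1 B1 D2 B2 ch1 ch2 [->].
by exists c, A, D1, B1, D2, B2.
Qed.

Lemma chain_dD s a b A D B : chain r d s d a b A D B -> (d <= r b - r a)%N.
Proof. by move=> /(chain_card r_inj d_ge2) <-; rewrite leq_addl. Qed.

Lemma chain_sum_edge s a b : r b = (r a).+1 -> chain_sum s 1 a b = 1.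
Proof.
move=> ab; rewrite /chain_sum.
rewrite (_ : chains _ _ _ _ = [set ([set a; b], finset.set0, finset.set0)]).
  by rewrite big_set1 /colour_weight big_set0.
apply/setP => -[[A D] B]; rewrite in_set1; apply/chainsP/eqP => /=.
- case/chain1_inv => -> [[_ -> ->] //|[A' [D' [B' [/chain_dD]]]]].
  by rewrite ab; move: d_ge2; clear; lia.
- by case=> -> -> ->; apply: chain_edge.
Qed.

(** Recovers the root polygon from the family, which makes its removal in [chain_sum_root]
    injective. *)
Lemma chain_root_in s a b A D B : chain r d s d a b A D B ->
  forall X, X \in A |: D -> a \in X -> b \in X -> X = A.
Proof.
move=> ch X; rewrite !inE => /orP[/eqP //|XD] aX bX.
have [z zA abz] := chain_mid r_inj d_ge2 ch.
have [_ _ uX] := chain_pieces ch XD.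
by case: (uX z zA) => [/(_ b bX)|/(_ a aX)]; ranks.
Qed.

Lemma setU1_inj (T : finType) (x : T) (C E : {set T}) :
  x \notin C -> x \notin E -> x |: C = x |: E -> C = E.
Proof. by move=> xC xE eqCE; rewrite -(setU1K xC) eqCE setU1K. Qed.

Lemma chain_sum_root s a b : r b <> (r a).+1 ->
  chain_sum s 1 a b = tau s * chain_sum (~~ s) d a b.
Proof.
move=> ab.
pose h (T : coloured_chain) : coloured_chain :=
  ([set a; b], T.1.1 |: T.1.2, if s then T.1.1 |: T.2 else T.2).
have inB T : T \in chains (~~ s) d a b -> T.1.1 \notin T.1.2 /\ T.1.1 \notin T.2.
  move=> /chainsP ch; have AD := chain_root_notin r_inj d_ge2 ch; split=> //.
  by apply: contra AD => /(subsetP (chain_blacks_sub ch)).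
rewrite /chain_sum (_ : chains s 1 a b = h @: chains (~~ s) d a b).
  rewrite big_imset /= => [|[[A D] B] [[A' D'] B'] TS TS'].
    rewrite big_distrr; apply: eq_bigr => T TS /=; have [AD AB] := inB T TS.
    rewrite /colour_weight big_setU1 //=; congr (_ * _).
      by case: (s); rewrite ?inE ?eqxx ?(negPf AB).
    apply: eq_bigr => X XD.
    have XA : X != T.1.1 by apply: contraNneq AD => <-.
    by case: (s); rewrite ?inE ?(negPf XA).
  have [/= AD AB] := inB _ TS; have [/= AD' AB'] := inB _ TS'.
  move: TS TS' => /chainsP/= ch /chainsP/= ch' [eqD eqB].
  have [_ aA bA _ _] := chain_itv ch.
  have AA : A = A'.
    by apply: (chain_root_in ch') => //; rewrite -eqD !inE eqxx.
  subst A'; rewrite (setU1_inj AD AD' eqD); congr (_, _, _).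
  by move: eqB; case: (s) => // /(setU1_inj AB AB').
apply/setP => -[[A D] B]; apply/chainsP/imsetP => /=.
- case/chain1_inv => -> [[] //|[A' [D' [B' [ch -> ->]]]]].
  by exists (A', D', B') => //; apply/chainsP.
- by case=> -[[A' D'] B'] /chainsP/= ch [-> -> ->]; apply: chain_root.
Qed.

Lemma setU_split_inj (T : finType) (P : {pred T}) (C1 C2 E1 E2 : {set T}) :
  {in C1, forall u, P u} -> {in E1, forall u, P u} ->
  {in C2, forall u, ~~ P u} -> {in E2, forall u, ~~ P u} ->
  C1 :|: C2 = E1 :|: E2 -> C1 = E1 /\ C2 = E2.
Proof.
move=> PC1 PE1 PC2 PE2 /setP eqCE; split; apply/setP => u; have := eqCE u;
  rewrite !inE; have [uP|uP] := boolP (P u).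
- by rewrite (contraTF (PC2 u) uP) (contraTF (PE2 u) uP) !orbF.
- by rewrite (contraNF (PC1 u) uP) (contraNF (PE1 u) uP).
- by rewrite (contraTF (PC2 u) uP) (contraTF (PE2 u) uP).
- by rewrite (contraNF (PC1 u) uP) (contraNF (PE1 u) uP).
Qed.

Lemma chain_sum_cons s k a b :
  chain_sum s k.+2 a b = \sum_c chain_sum s 1 a c * chain_sum s k.+1 c b.
Proof.
pose h (u : V * (coloured_chain * coloured_chain)) : coloured_chain :=
  (a |: u.2.2.1.1, u.2.1.1.2 :|: u.2.2.1.2, u.2.1.2 :|: u.2.2.2).
pose S := [set u : V * (coloured_chain * coloured_chain) |
  (u.2.1 \in chains s 1 a u.1) && (u.2.2 \in chains s k.+1 u.1 b)].
transitivity (\sum_(u in S) (colour_weight u.2.1.1.2 u.2.1.2 *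
                             colour_weight u.2.2.1.2 u.2.2.2)); last first.
  symmetry.
  transitivity (\sum_c \sum_(u |
        (u.1 \in chains s 1 a c) && (u.2 \in chains s k.+1 c b))
      (colour_weight u.1.1.2 u.1.2 * colour_weight u.2.1.2 u.2.2)).
    by apply: eq_bigr => c _; rewrite /chain_sum big_distrlr pair_big.
  rewrite pair_big_dep /=.
  by apply: eq_bigl => u; rewrite !inE.
rewrite /chain_sum (_ : chains s k.+2 a b = h @: S); last first.
  apply/setP => -[[A D] B]; apply/chainsP/imsetP => /=.
  - move/chain_cons_inv => [c [A' [D1 [B1 [D2 [B2 [ch1 ch2 -> -> ->]]]]]]].
    exists (c, (([set a; c], D1, B1), (A', D2, B2))) => //.
    by rewrite inE /=; apply/andP; split; apply/chainsP.
  - case=> -[c [[[A1 D1] B1] [[A2 D2] B2]]]; rewrite inE /=.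
    move=> /andP[/chainsP/= ch1 /chainsP/= ch2] [-> -> ->].
    have [eqA _] := chain1_inv ch1; rewrite eqA in ch1.
    exact: chain_cons ch1 ch2.
rewrite big_imset /= => [|[c [[[A1 D1] B1] [[A2 D2] B2]]]
  [c' [[[A1' D1'] B1'] [[A2' D2'] B2']]]].
  apply: eq_bigr => -[c [[[A1 D1] B1] [[A2 D2] B2]]]; rewrite inE /=.
  move=> /andP[/chainsP/= ch1 /chainsP/= ch2].
  have [c1 c2] := chain_cons_colour r_inj d_ge2 ch1 ch2.
  rewrite /colour_weight (eq_bigl [predU D1 & D2]) => [|X]; last by rewrite !inE.
  rewrite bigU /=; last first.
    rewrite -setI_eq0; apply/eqP/setP => X; rewrite !inE; apply/negP => /andP[X1 X2].
    exact: (chain_cons_disjoint r_inj d_ge2 ch1 ch2 X1 X2).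
  by congr (_ * _); apply: eq_bigr => X XD; [rewrite c1 | rewrite c2].
rewrite !inE /= => /andP[/asboolP ch1 /asboolP ch2].
move=> /andP[/asboolP ch1' /asboolP ch2'] [eqA eqD eqB].
have [ac _ _ _ _] := chain_itv ch1.
have [ac' _ _ _ _] := chain_itv ch1'.
have [cb cA _ /subsetP sA _] := chain_itv ch2.
have [cb' cA' _ /subsetP sA' _] := chain_itv ch2'.
have aA : a \notin A2 by apply/negP => /sA /itv_rank; ranks.
have aA' : a \notin A2' by apply/negP => /sA' /itv_rank; ranks.
(* Without [a] the two vertex sets agree, and their least member is the cut vertex. *)
have AA := setU1_inj aA aA' eqA; subst A2'.
have cc : c = c'.
  by apply: r_inj; have := itv_rank (sA _ cA'); have := itv_rank (sA' _ cA); ranks.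
subst c'.
have [eA1 _] := chain1_inv ch1; have [eA1' _] := chain1_inv ch1'; subst A1 A1'.
(* [P] tells the two parts of a union apart: a member over [[c, b]] has too many vertices to lie
   over [[a, c]] as well. *)
pose P X := X \subset itv r a c.
have in1 D B A X : chain r d s 1 a c A D B -> X \in D -> P X.
  by move=> ch /(chain_pieces ch)[].
have in2 D B A X : chain r d s k.+1 c b A D B -> X \in D -> ~~ P X.
  move=> ch /(chain_pieces ch)[cX sX _]; apply/negP => PX.
  by apply: (big_polygon_itv_meet r_inj _ PX sX); ranks.
have inB s' k' x y A D B X : chain r d s' k' x y A D B -> X \in B -> X \in D.
  by move/chain_blacks_sub/subsetP; apply.
have [||||-> ->] := setU_split_inj (P := P) _ _ _ _ eqD; rewrite /prop_in1; eauto.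
have [||||-> ->] := setU_split_inj (P := P) _ _ _ _ eqB; rewrite /prop_in1; eauto.
Qed.

End ChainSums.

(** * Chain sums as coefficients of power series *)

Lemma fcoefCM (K : comNzRingType) (c : K) (f : fps K) n :
  fcoef (fpsC c * f) n = c * fcoef f n.
Proof.
rewrite /= big_ord_recl /= subn0 big1 ?addr0 // => i _.
by rewrite mul0r.
Qed.

Lemma fcoefXM (K : comNzRingType) (f : fps K) n :
  fcoef (fpsX * f) n = if n is m.+1 then fcoef f m else 0.
Proof.
case: n => [|n]; first by rewrite /= big_ord1 /= mul0r.
rewrite /= !big_ord_recl /= mul0r add0r mul1r subSS subn0 big1 ?addr0 // => i _.
by rewrite mul0r.
Qed.

Section ChainSeries.
Import mathcomp.boot.fintype mathcomp.boot.finset.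
Variable d : nat.
Hypothesis d_ge2 : (2 <= d)%N.
Variables (K : comNzRingType) (tau : bool -> K).

(** By [chain_card], a first edge carrying [i] polygons has length [d.-1 * i + 1], so the cut vertex
    is one of the [h i]. This turns the sum over vertices into a Cauchy product. *)
Lemma chain_sum_cons_fit (V : finType) (r : V -> nat) s k n (a b : V) :
  injective r -> (forall b m, (m <= r b)%N -> exists y, r y = m) ->
  r b = (r a + (d.-1 * n + k.+2))%N ->
  exists h : 'I_n.+1 -> V, (forall i, r (h i) = (r a + (d.-1 * i + 1))%N) /\
    chain_sum r d tau s k.+2 a b =
    \sum_i chain_sum r d tau s 1 a (h i) * chain_sum r d tau s k.+1 (h i) b.
Proof.
move=> r_inj r_onto rab.
have d1 : (0 < d.-1)%N by move: d_ge2; clear; lia.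
have ex (i : 'I_n.+1) : {c | r c = (r a + (d.-1 * i + 1))%N}.
  apply/cid/(r_onto b); rewrite rab.
  by have := leq_mul (leqnn d.-1) (leq_ord i); clear; lia.
exists (fun i => sval (ex i)); split=> [i|]; first exact: (svalP (ex i)).
rewrite (chain_sum_cons r_inj d_ge2).
rewrite (bigID (mem [set sval (ex i) | i in 'I_n.+1])) /= [X in _ + X]big1 ?addr0.
  rewrite big_imset //= => i j _ _ eqij; apply/val_inj/eqP.
  have := svalP (ex i); rewrite eqij (svalP (ex j)) => /eqP.
  by rewrite eqn_add2l eqn_add2r eqn_pmul2l // eq_sym.
move=> c cN; have [e1|/set0Pn[T1 /chainsP ch1]] := eqVneq (chains r d s 1 a c) finset.set0.
  by rewrite /chain_sum e1 big_set0 mul0r.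
have [e2|/set0Pn[T2 /chainsP ch2]] := eqVneq (chains r d s k.+1 c b) finset.set0.
  by rewrite {2}/chain_sum e2 big_set0 mulr0.
have [ac _ _ _ _] := chain_itv ch1; have [cb _ _ _ _] := chain_itv ch2.
have := chain_card r_inj d_ge2 ch1; have := chain_card r_inj d_ge2 ch2.
move: #|T1.1.2| #|T2.1.2| => j i e2 e1.
have lt_in : (j < n.+1)%N.
  rewrite ltnS -(leq_pmul2l d1).
  by move: (d.-1 * j)%N (d.-1 * i)%N (d.-1 * n)%N rab ac cb e1 e2; clear; lia.
case/imsetP: cN; exists (Ordinal lt_in) => //.
by apply: r_inj; rewrite (svalP (ex _)) /=; move: (d.-1 * j)%N ac e1; clear; lia.
Qed.

Definition dissection_series s : fps K :=
  Fps (fun n => chain_sum (@nat_of_ord (d.-1 * n).+2) d tau s 1 ord0 ord_max).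

Lemma ord_onto N (b : 'I_N) m : (m <= b)%N -> exists y : 'I_N, y = m :> nat.
Proof. by move=> mb; exists (Ordinal (leq_ltn_trans mb (ltn_ord b))). Qed.

(** Nested induction on [n] and [k]: removing a root polygon lowers [n]; cutting off the first edge
    lowers [k], and [n] as well unless that edge carries no polygon. *)
Lemma chain_sum_series n k s (V : finType) (r : V -> nat) (a b : V) :
  injective r -> (forall b m, (m <= r b)%N -> exists y, r y = m) ->
  r b = (r a + (d.-1 * n + k.+1))%N ->
  chain_sum r d tau s k.+1 a b = fcoef (dissection_series s ^+ k.+1) n.
Proof.
have [n0 n0n] := ubnP n; elim: n0 n n0n k s V r a b => // n0 IHn n n_n0.
have base s (V : finType) (r : V -> nat) (a b : V) : injective r ->
    (forall b m, (m <= r b)%N -> exists y, r y = m) ->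
    r b = (r a + (d.-1 * n + 1))%N ->
    chain_sum r d tau s 1 a b = fcoef (dissection_series s) n.
  move=> r_inj r_onto rab /=.
  case: n n_n0 rab => [|n] n_n0 rab.
    rewrite (chain_sum_edge r_inj d_ge2); last by move: rab; rewrite muln0; clear; lia.
    by rewrite (chain_sum_edge (@ord_inj _) d_ge2) //= muln0.
  (* Removing the root leaves [d] edges and [n] polygons: the length [d.-1 * n.+1 + 1] equals
     [d.-1 * n + d]. This is done both in [V] and in the model polygon defining the series. *)
  have dn : (d.-1 * n.+1 = d.-1 * n + d.-1)%N by rewrite mulnSr.
  have IHd s' (V' : finType) (r' : V' -> nat) (a' b' : V') : injective r' ->
      (forall b m, (m <= r' b)%N -> exists y, r' y = m) ->
      r' b' = (r' a' + (d.-1 * n + d))%N ->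
      chain_sum r' d tau s' d a' b' = fcoef (dissection_series s' ^+ d) n.
    move=> r'_inj r'_onto; have dE : d.-1.+1 = d by move: d_ge2; clear; lia.
    by have := IHn n n_n0 d.-1 s' V' r' a' b' r'_inj r'_onto; rewrite dE; apply.
  rewrite (chain_sum_root r_inj d_ge2);
    last by move: rab d_ge2; rewrite dn; move: (d.-1 * n)%N; clear; lia.
  rewrite (chain_sum_root (@ord_inj _) d_ge2) /=;
    last by move: d_ge2; rewrite dn; move: (d.-1 * n)%N; clear; lia.
  rewrite !IHd //; try exact: ord_inj.
  - by move=> b' m; apply: ord_onto.
  - by rewrite /= add0n dn; move: d_ge2 (d.-1 * n)%N; clear; lia.
  - by rewrite rab dn; move: d_ge2 (d.-1 * n)%N; clear; lia.
elim=> [|k IHk] s V r a b r_inj r_onto rab; first exact: base.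
have [h [rh ->]] := chain_sum_cons_fit s r_inj r_onto rab.
rewrite exprS.
transitivity (\sum_(i < n.+1) fcoef (dissection_series s) i *
    fcoef (dissection_series s ^+ k.+1) (n - i)); last by [].
apply: eq_bigr => i _.
have di : (d.-1 * n = d.-1 * i + d.-1 * (n - i))%N by rewrite -mulnDr (subnKC (leq_ord i)).
have rhb : r b = (r (h i) + (d.-1 * (n - i) + k.+1))%N.
  by rewrite rh rab di; move: (d.-1 * _)%N (d.-1 * _)%N; clear; lia.
have rhi : r (h i) = (r a + (d.-1 * i + 1))%N by rewrite rh.
congr (_ * _).
  have [i_n|n_i] := ltnP i n; last first.
    have i_n : i = n :> nat by apply/eqP; rewrite eqn_leq leq_ord.
    by rewrite i_n in rhi *; apply: base.
  by apply: (IHn i _ 0%N) => //; apply: leq_trans i_n _.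
have [i0|i0] := posnP i.
  by rewrite i0 subn0 in rhb *; apply: IHk.
apply: IHn => //; move: n_n0 i0 (leq_ord i); move: (nat_of_ord i); clear; lia.
Qed.

Lemma dissection_series_eq s :
  dissection_series s = 1 + fpsC (tau s) * fpsX * dissection_series (~~ s) ^+ d.
Proof.
have coefD (f g : fps K) n : fcoef (f + g) n = fcoef f n + fcoef g n by [].
apply: fpsP => n; rewrite -mulrA coefD fcoefCM fcoefXM.
case: n => [|n].
  rewrite mulr0 addr0 /= (chain_sum_edge (@ord_inj _) d_ge2) //=.
  by rewrite muln0.
have dn : (d.-1 * n.+1 = d.-1 * n + d.-1)%N by rewrite mulnSr.
have dE : d.-1.+1 = d by move: d_ge2; clear; lia.
rewrite /= (chain_sum_root (@ord_inj _) d_ge2) /=;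
    last by move: d_ge2; rewrite dn; move: (d.-1 * n)%N; clear; lia.
rewrite add0r; congr (_ * _).
have := @chain_sum_series n d.-1 (~~ s) _ _ ord0 ord_max (@ord_inj (d.-1 * n.+1).+2)
  (@ord_onto _).
rewrite dE; apply; rewrite /= add0n dn; move: d_ge2 (d.-1 * n)%N; clear; lia.
Qed.

End ChainSeries.

(** * Convex position *)

Section Orientation.
Variable R : realType.
Implicit Types (a b c q x y z w : 'rV[R]_2) (e l : R).

Lemma orientC a b c : orient b c a = orient a b c.
Proof. by rewrite /orient; ring. Qed.

Lemma orientN a b c : orient b a c = - orient a b c.
Proof. by rewrite /orient; ring. Qed.

Lemma orient_aba a b : orient a b a = 0.
Proof. by rewrite /orient; ring. Qed.

Lemma orient_abb a b : orient a b b = 0.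
Proof. by rewrite /orient; ring. Qed.

(** The affine dependence of four points of the plane, arranged so that all coefficients are
    positive when the segments [uv] and [ab] cross, as in [hull_chord]. *)
Lemma orient_four_points a b u v :
  orient a b v *: u + orient a u b *: v = orient u b v *: a + orient a u v *: b.
Proof.
by apply/rowP => i; have [->|->] : i = 0 \/ i = 1;
  [case: i => -[|[|//]] ?; [left|right]; apply/val_inj
  |rewrite /orient !mxE; ring|rewrite /orient !mxE; ring].
Qed.

Lemma orient_four_weights a b u v :
  orient a b v + orient a u b = orient u b v + orient a u v.
Proof. by rewrite /orient; ring. Qed.

Lemma orient_sum (I : finType) (A : {set I}) (p : I -> 'rV[R]_2) (w : I -> R) a b :
  \sum_(i in A) w i = 1 ->
  orient a b (\sum_(i in A) w i *: p i) = \sum_(i in A) w i * orient a b (p i).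
Proof.
move=> w1; set q := \sum_(i in A) _.
have qE j : q 0 j = \sum_(i in A) w i * p i 0 j.
  by rewrite summxE; apply: eq_bigr => i _; rewrite mxE.
have -> : orient a b q =
    (b 0 0 - a 0 0) * q 0 1 - (b 0 1 - a 0 1) * q 0 0 +
    ((b 0 1 - a 0 1) * a 0 0 - (b 0 0 - a 0 0) * a 0 1) * \sum_(i in A) w i.
  by rewrite w1 /orient; ring.
rewrite !qE !mulr_sumr -sumrB -big_split /=; apply: eq_bigr => i _.
by rewrite /orient; ring.
Qed.

Definition open_triangle a b c q :=
  [/\ 0 < orient a b q, 0 < orient b c q & 0 < orient c a q].

Lemma barycentric a b c q : orient a b c != 0 ->
  q = (orient b c q / orient a b c) *: a + (orient c a q / orient a b c) *: b +
      (orient a b q / orient a b c) *: c.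
Proof.
move=> abc; apply: (scalerI abc).
rewrite !scalerDr !scalerA.
have E (v : R) : orient a b c * (v / orient a b c) = v by rewrite mulrC divfK.
rewrite !E; apply/rowP => i; have [->|->] : i = 0 \/ i = 1.
- by case: i => -[|[|//]] ?; [left|right]; apply/val_inj.
- by rewrite /orient !mxE; ring.
- by rewrite /orient !mxE; ring.
Qed.

Lemma barycentric_weights a b c q : orient b c q + orient c a q + orient a b q = orient a b c.
Proof. by rewrite /orient; ring. Qed.

Lemma small_perturbation (c e : R) : 0 < c ->
  exists2 l, 0 < l & forall l', 0 < l' <= l -> 0 < c + l' * e.
Proof.
have e1 : 0 < `|e| + 1 by rewrite ltr_wpDl.
move=> c0; exists (c / (`|e| + 1)); first by rewrite divr_gt0.
move=> l' /andP[l0]; rewrite ler_pdivlMr // => lc.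
have : - (l' * e) <= l' * `|e| by rewrite -mulrN ler_pM2l // ler_normr lexx orbT.
lra.
Qed.

Lemma orient_affine a b x y z la mu l : la + mu = 1 ->
  orient a b (la *: x + mu *: y + l *: z) =
  la * orient a b x + mu * orient a b y + l * (orient a b z - orient a b 0).
Proof.
move=> /(canRL (addKr _)) ->; rewrite /orient !mxE; ring.
Qed.

(* The chords ab and yz meet in the point m = la a + mu b, and the direction
   (y - z) + (b - a), scaled by s, points from m into both triangles. *)
Lemma crossing_triangles a b c y z w : 0 < orient a b c -> 0 < orient y z w ->
  orient a b y * orient a b z < 0 -> orient y z a * orient y z b < 0 ->
  exists q, open_triangle a b c q /\ open_triangle y z w q.
Proof.
move=> abc yzw ab yz.
pose s := orient y z b - orient y z a.
have sE : s = orient a b y - orient a b z by rewrite /s /orient; ring.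
have opp u v : u * v < 0 -> v - u != 0 /\ 0 < v / (v - u) :> R.
  move=> uv; have vu : v - u != 0.
    by rewrite subr_eq0; apply/eqP => vu; move: uv; rewrite vu; nra.
  split=> //; suff : 0 < (v / (v - u)) * (v - u) ^+ 2.
    by rewrite pmulr_lgt0 // lt0r sqr_ge0 sqrf_eq0 vu.
  by rewrite (_ : _ * _ = v * (v - u)); [nra|field].
have [s0 la0] := opp _ _ yz; rewrite -/s in s0 la0.
have := opp (orient y z b) (orient y z a); rewrite mulrC => /(_ yz)[_ mu0].
have := opp (orient a b z) (orient a b y); rewrite mulrC -sE => /(_ ab)[_ mu0'].
have [_ la0'] := opp (orient a b y) (orient a b z) ab.
(* The weights for which [la *: a + mu *: b] lies on the line [yz]. *)
pose la := orient y z b / s; pose mu := - orient y z a / s.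
have la_gt0 : 0 < la by [].
have s2 : 0 < s ^+ 2 by rewrite lt0r sqr_ge0 sqrf_eq0 s0.
have mu_gt0 : 0 < mu by rewrite /mu mulNr -mulrN -invrN opprB.
have la'_gt0 : 0 < - orient a b z / s by rewrite mulNr -mulrN -invrN sE opprB.
have lamu : la + mu = 1 by rewrite /la /mu -mulrDl divff.
have laE : s * la = orient y z b by rewrite /la mulrC divfK.
have muE : s * mu = - orient y z a by rewrite /mu mulrC divfK.
have sE' : s = orient y z b - orient y z a by [].
clearbody la mu s.
(* Along [y - z + (b - a)] both [orient a b] and [orient y z] change at rate [s]; the extra factor
   [s] makes the rate [s ^+ 2], positive for either sign of [s]. *)
pose q e := la *: a + mu *: b + (e * s) *: (y - z + (b - a)).
pose slope x x' := orient x x' (y - z + (b - a)) - orient x x' 0.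
have qE x x' e : orient x x' (q e) =
    (la * orient x x' a + mu * orient x x' b) + e * (s * slope x x').
  by rewrite orient_affine // mulrA.
have Eab e : orient a b (q e) = e * s ^+ 2.
  rewrite qE (_ : slope a b = s); last by rewrite /slope sE /orient !mxE; ring.
  by rewrite orient_aba orient_abb !mulr0 !add0r expr2.
have Eyz e : orient y z (q e) = e * s ^+ 2.
  rewrite qE (_ : slope y z = s); last by rewrite /slope sE' /orient !mxE; ring.
  rewrite -laE -[orient y z a]opprK -muE expr2 mulrN.
  by rewrite [la * _]mulrCA [mu * _]mulrCA [la * mu]mulrC addNr add0r.
have Ebc e : orient b c (q e) = la * orient a b c + e * (s * slope b c).
  by rewrite qE orientC (_ : orient b c b = 0) ?mulr0 ?addr0 // /orient; ring.
have Eca e : orient c a (q e) = mu * orient a b c + e * (s * slope c a).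
  by rewrite qE orient_abb mulr0 add0r -orientC.
have Ezw e : orient z w (q e) = - orient a b z / s * orient y z w + e * (s * slope z w).
  rewrite qE; congr (_ + _); apply: (mulfI s0).
  rewrite mulrDr !mulrA laE muE [s * _]mulrC mulfK //.
  by rewrite /orient; ring.
have Ewy e : orient w y (q e) = orient a b y / s * orient y z w + e * (s * slope w y).
  rewrite qE; congr (_ + _); apply: (mulfI s0).
  rewrite mulrDr !mulrA laE muE [s * _]mulrC mulfK //.
  by rewrite /orient; ring.
(* The other four orientations are already positive at [m], so they survive a small step. *)
have [l1 l1_gt0 h1] := small_perturbation (s * slope b c) (mulr_gt0 la_gt0 abc).
have [l2 l2_gt0 h2] := small_perturbation (s * slope c a) (mulr_gt0 mu_gt0 abc).
have [l3 l3_gt0 h3] := small_perturbation (s * slope z w) (mulr_gt0 la'_gt0 yzw).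
have [l4 l4_gt0 h4] := small_perturbation (s * slope w y) (mulr_gt0 mu0' yzw).
pose l := Num.min (Num.min l1 l2) (Num.min l3 l4).
have l_gt0 : 0 < l by rewrite !lt_min l1_gt0 l2_gt0 l3_gt0.
have [ll1 ll2 ll3 ll4] : [/\ 0 < l <= l1, 0 < l <= l2, 0 < l <= l3 & 0 < l <= l4].
  by rewrite l_gt0 /l !ge_min !lexx ?orbT.
exists (q l); split; split.
- by rewrite Eab mulr_gt0.
- by rewrite Ebc; apply: h1.
- by rewrite Eca; apply: h2.
- by rewrite Eyz mulr_gt0.
- by rewrite Ezw; apply: h3.
- by rewrite Ewy; apply: h4.
Qed.

End Orientation.

Section ConvexPolygon.
Import mathcomp.boot.fintype mathcomp.boot.finset.
Variables (R : realType) (N : nat) (p : 'I_N -> 'rV[R]_2) (r : 'I_N -> nat).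
Hypothesis r_inj : injective r.
Hypothesis convex : forall i j k, (r i < r j < r k)%N -> 0 < orient (p i) (p j) (p k).
Implicit Types (a b i j k u v x y : 'I_N) (A X Y : {set 'I_N}) (w : 'I_N -> R).

(** Extending the weights by zero lets hulls of different index sets share sums over the same
    range. *)
Definition weights A w :=
  [/\ forall i, 0 <= w i, forall i, i \notin A -> w i = 0 & \sum_i w i = 1].

Lemma hullP A q : hull p A q <-> exists2 w, weights A w & q = \sum_i w i *: p i.
Proof.
split=> [[w [w0 w1 ->]]|[w [w0 wA w1] ->]].
- exists (fun i => if i \in A then w i else 0).
    split=> [i|i /negPf ->|] //; first by case: ifP.
    by rewrite -big_mkcond.
  rewrite big_mkcond; apply: eq_bigr => i _.
  by case: ifP => // _; rewrite scale0r.
- exists w; split=> //.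
    rewrite -w1 [RHS](bigID (mem A)) /= [X in _ + X]big1 ?addr0 //.
  rewrite [LHS](bigID (mem A)) /= [X in _ + X]big1 ?addr0 // => i /wA ->.
  by rewrite scale0r.
Qed.

Lemma hullS A X : A \subset X -> (hull p A `<=` hull p X)%classic.
Proof.
move=> /subsetP AX q /hullP[w [w0 wA w1] ->]; apply/hullP; exists w => //.
by split=> // i iX; apply: wA; apply: contra iX => /AX.
Qed.

Lemma hull_orient_ge0 A a b q : (forall i, i \in A -> 0 <= orient (p a) (p b) (p i)) ->
  hull p A q -> 0 <= orient (p a) (p b) q.
Proof.
move=> A0 [w [w0 w1 ->]]; rewrite orient_sum //.
by apply: sumr_ge0 => i iA; rewrite mulr_ge0 ?A0.
Qed.

Lemma hull_orient_le0 A a b q : (forall i, i \in A -> orient (p a) (p b) (p i) <= 0) ->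
  hull p A q -> orient (p a) (p b) q <= 0.
Proof.
move=> A0 [w [w0 w1 ->]]; rewrite orient_sum //.
by apply: sumr_le0 => i iA; rewrite mulr_ge0_le0 ?A0.
Qed.

Lemma orient_outside a b i : (r a < r b)%N -> i \in outside r a b ->
  0 <= orient (p a) (p b) (p i).
Proof.
move=> ab; rewrite inE => /orP[|]; rewrite leq_eqVlt => /orP[/eqP/r_inj|] h.
- by rewrite h orient_aba.
- by rewrite -orientC -orientC ltW // convex // h.
- by rewrite -h orient_abb.
- by rewrite ltW // convex // ab.
Qed.

Lemma orient_itv a b i : i \in itv r a b -> orient (p a) (p b) (p i) <= 0.
Proof.
move=> /itv_rank[]; rewrite leq_eqVlt => /orP[/eqP/r_inj <-|ai].
  by rewrite orient_aba.
rewrite leq_eqVlt => /orP[/eqP/r_inj <-|ib]; first by rewrite orient_abb.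
by rewrite -orientC orientN oppr_le0 orientC ltW // convex // ai.
Qed.

Lemma orient_rank_neq0 i j k : i != j -> i != k -> j != k ->
  orient (p i) (p j) (p k) != 0.
Proof.
move=> ij ik jk.
have pos i' j' k' : (r i' < r j')%N -> (r j' < r k')%N ->
    orient (p i') (p j') (p k') != 0.
  by move=> ij' jk'; rewrite gt_eqF // convex // ij'.
have neq x y : x != y -> (r x < r y)%N \/ (r y < r x)%N.
  by case: (ltngtP (r x) (r y)) => [|//|/r_inj ->]; rewrite ?eqxx //; [left|right].
have oppE (f g h : 'rV[R]_2) : (orient f g h != 0) = (orient g f h != 0).
  by rewrite orientN oppr_eq0.
case: (neq _ _ ij) (neq _ _ ik) (neq _ _ jk) => {}ij [] {}ik [] {}jk.
- exact: pos.
- by rewrite orientC oppE pos.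
- by have := ltn_trans ij jk; rewrite ltnNge ltnW.
- by rewrite orientC pos.
- by rewrite oppE pos.
- by have := ltn_trans ik jk; rewrite ltnNge ltnW.
- by rewrite -orientC pos.
- by rewrite -orientC oppE pos.
Qed.

Lemma sum_delta_scale (g : 'I_N -> 'rV[R]_2) (c : R) a :
  \sum_i (c * (i == a)%:R) *: g i = c *: g a.
Proof.
rewrite (bigD1 a) //= eqxx mulr1 big1 ?addr0 // => i /negPf ->.
by rewrite mulr0 scale0r.
Qed.

Lemma sum_delta (c : R) a : \sum_i c * (i == a)%:R = c.
Proof.
by rewrite (bigD1 a) //= eqxx mulr1 big1 ?addr0 // => i /negPf ->; rewrite mulr0.
Qed.

(* If some weight sits on u strictly between a and b and some on v strictly
   outside, the relation [orient_four_points] trades weight of u and v against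
   weight of a and b until u or v has no weight left. *)
Lemma hull_chord A a b q : (r a < r b)%N -> hull p A q ->
  hull p ((A :&: itv r a b) :|: [set a; b]) q \/
  hull p ((A :&: outside r a b) :|: [set a; b]) q.
Proof.
move=> ab /hullP[w wA ->].
have [m] := ubnP #|[set i | (w i != 0) && (i \notin [set a; b])]|.
have {wA} : weights (A :|: [set a; b]) w.
  by case: wA => w0 wA w1; split=> // i; rewrite inE negb_or => /andP[/wA].
elim: m w => // m IH w [w0 wA w1] wm.
have [/existsP[u /andP[wu u_in]]|no_u] :=
  boolP [exists u, (w u != 0) && (r a < r u < r b)%N]; last first.
  right; apply/hullP; exists w => //; split=> // i.
  rewrite !inE !negb_or negb_and => /andP[iA /andP[ia ib]].
  apply/eqP; apply: contraNT no_u => wi; apply/existsP; exists i; rewrite wi /=.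
  have : i \in A :|: [set a; b].
    by apply: contraNT wi => /wA ->.
  rewrite !inE (negPf ia) (negPf ib) !orbF => iA'; rewrite iA' /= in iA.
  by move: iA; rewrite negb_or -!ltnNge.
have [/existsP[v /andP[wv v_out]]|no_v] :=
  boolP [exists v, (w v != 0) && ((r v < r a) || (r b < r v))%N]; last first.
  left; apply/hullP; exists w => //; split=> // i.
  rewrite !inE !negb_or negb_and => /andP[iA /andP[ia ib]].
  apply/eqP; apply: contraNT no_v => wi; apply/existsP; exists i; rewrite wi /=.
  have : i \in A :|: [set a; b].
    by apply: contraNT wi => /wA ->.
  rewrite !inE (negPf ia) (negPf ib) !orbF => iA'; rewrite iA' /= in iA.
  by move: iA; rewrite negb_and -!ltnNge.
have /andP[au ub] := u_in.
have [al_gt0 be_gt0 ga_gt0 de_gt0] : [/\ 0 < orient (p a) (p b) (p v),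
    0 < orient (p a) (p u) (p b), 0 < orient (p u) (p b) (p v) &
    0 < orient (p a) (p u) (p v)].
  have abu : 0 < orient (p a) (p u) (p b) by apply: convex; rewrite au.
  case/orP: v_out => [va|bv]; split=> //.
  - by rewrite orientC; apply: convex; rewrite va.
  - by rewrite orientC; apply: convex; rewrite (ltn_trans va au).
  - by rewrite orientC; apply: convex; rewrite va.
  - by apply: convex; rewrite ab.
  - by apply: convex; rewrite ub.
  - by apply: convex; rewrite au (ltn_trans ub bv).
have rel := orient_four_points (p a) (p b) (p u) (p v).
have rel1 := orient_four_weights (p a) (p b) (p u) (p v).
move: al_gt0 be_gt0 ga_gt0 de_gt0 rel rel1.
move: (orient (p a) (p b) (p v)) (orient (p a) (p u) (p b)) (orient (p u) (p b) (p v))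
  (orient (p a) (p u) (p v)) => al be ga de al_gt0 be_gt0 ga_gt0 de_gt0 rel rel1.
have rank_neq x y : (r x < r y)%N || (r y < r x)%N -> (x == y) = false.
  by apply: contraTF => /eqP ->; rewrite ltnn.
have [ua ub'] : (u == a) = false /\ (u == b) = false.
  by rewrite !rank_neq ?au ?ub ?orbT.
have [va vb] : (v == a) = false /\ (v == b) = false.
  by rewrite !rank_neq //; case/orP: v_out => [va|bv];
    rewrite ?va ?(ltn_trans va ab) ?bv ?(ltn_trans ab bv) ?orbT.
have uv : (u == v) = false.
  rewrite rank_neq //; case/orP: v_out => [va'|bv].
    by rewrite (ltn_trans va' au) orbT.
  by rewrite (ltn_trans ub bv).
pose f i := ga * (i == a)%:R + de * (i == b)%:R - al * (i == u)%:R - be * (i == v)%:R.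
have fu : f u = - al by rewrite /f ua ub' uv eqxx /=; ring.
have fv : f v = - be by rewrite /f va vb eq_sym uv eqxx /=; ring.
have f_ge0 i : i != u -> i != v -> 0 <= f i.
  move=> /negPf iu /negPf iv; rewrite /f iu iv !mulr0 !subr0.
  by rewrite addr_ge0 // mulr_ge0 ?ler0n // ltW.
have f_out i : i \notin [set a; b] -> i != u -> i != v -> f i = 0.
  rewrite !inE negb_or => /andP[/negPf ia /negPf ib] /negPf iu /negPf iv.
  by rewrite /f ia ib iu iv /=; ring.
have f_sum : \sum_i f i = 0.
  rewrite sumrB sumrB big_split /= !sum_delta -[ga + de]rel1; ring.
have f_comb : \sum_i f i *: p i = 0.
  rewrite /f; under eq_bigr do rewrite 2!scalerBl scalerDl.
  rewrite sumrB sumrB big_split /= !sum_delta_scale -rel.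
  by rewrite [X in X - _]addrC addKr subrr.
(* The largest multiple of the relation [f] that keeps the weights of [u] and [v] nonnegative; it
   exhausts one of them. *)
pose la := Num.min (w u / al) (w v / be).
have la_ge0 : 0 <= la by rewrite le_min !divr_ge0 // ltW.
have la_u : la * al <= w u by rewrite -ler_pdivlMr // ge_min lexx.
have la_v : la * be <= w v by rewrite -ler_pdivlMr // ge_min lexx orbT.
have la_eq : la * al = w u \/ la * be = w v.
  by rewrite /la; case: leP => _; [left|right]; rewrite divfK // gt_eqF.
pose w' i := w i + la * f i.
have w'u : w' u = w u - la * al by rewrite /w' fu mulrN.
have w'v : w' v = w v - la * be by rewrite /w' fv mulrN.
have inA i : w i != 0 -> i \in A :|: [set a; b] by apply: contraNT => /wA ->.
have -> : \sum_i w i *: p i = \sum_i w' i *: p i.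
  rewrite /w'; under [RHS]eq_bigr do rewrite scalerDl -scalerA.
  by rewrite big_split /= -scaler_sumr f_comb scaler0 addr0.
apply: IH; first split.
- move=> i; have [->|iu] := eqVneq i u; first by rewrite w'u subr_ge0.
  have [->|iv] := eqVneq i v; first by rewrite w'v subr_ge0.
  by rewrite addr_ge0 // mulr_ge0 // f_ge0.
- move=> i iA; have iab : i \notin [set a; b].
    by apply: contra iA => iab; rewrite in_setU iab orbT.
  have iu : i != u by apply: contraNneq iA => ->; apply: inA.
  have iv : i != v by apply: contraNneq iA => ->; apply: inA.
  by rewrite /w' wA // f_out // mulr0 addr0.
- by rewrite /w' big_split /= -mulr_sumr f_sum mulr0 addr0.
- rewrite -ltnS; apply: leq_trans wm; rewrite ltnS; apply: proper_card.
  apply/properP; split.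
    apply/subsetP => i; rewrite !in_set => /andP[w'i iab]; rewrite iab andbT.
    have [->//|iu] := eqVneq i u; have [->//|iv] := eqVneq i v.
    by move: w'i; rewrite /w' f_out ?mulr0 ?addr0 // in_setU.
  case: la_eq => [eu|ev]; [exists u | exists v].
  + by rewrite !inE wu ua ub'.
  + by rewrite !inE w'u eu subrr eqxx.
  + by rewrite !inE wv va vb.
  + by rewrite !inE w'v ev subrr eqxx.
Qed.

End ConvexPolygon.

(** * Half-planes and interiors *)

Section OrientTopology.
Variable R : realType.
Implicit Types a b c q v : 'rV[R]_2.

Lemma orient_continuous a b : continuous (orient a b).
Proof.
move=> q; rewrite /orient.
have coord j : {for q, continuous (fun q' : 'rV[R]_2 => q' 0 j)} by exact: coord_continuous.
have coordB j (l m : R) : {for q, continuous (fun q' : 'rV[R]_2 => l * (q' 0 j - m))}.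
  apply: (@continuousM R _ (fun=> l) (fun q' : 'rV[R]_2 => q' 0 j - m)).
    exact: cst_continuous.
  apply: (@continuousB R _ _ (fun q' : 'rV[R]_2 => q' 0 j : R) (fun=> m)) => //.
  exact: cst_continuous.
exact: (@continuousB R _ _ (fun q' : 'rV[R]_2 => (b 0 0 - a 0 0) * (q' 0 1 - a 0 1) : R)
  (fun q' : 'rV[R]_2 => (b 0 1 - a 0 1) * (q' 0 0 - a 0 0) : R) q
  (coordB _ _ _) (coordB _ _ _)).
Qed.

Lemma open_triangle_open a b c : open [set q | open_triangle a b c q]%classic.
Proof.
have pos (x y : 'rV[R]_2) : open [set q | 0 < orient x y q]%classic.
  apply: (@open_comp _ _ (orient x y) [set l | 0 < l]%classic) => [q _|].
    exact: orient_continuous.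
  exact: open_gt.
have -> : [set q | open_triangle a b c q]%classic =
    ([set q | 0 < orient a b q] `&`
      ([set q | 0 < orient b c q] `&` [set q | 0 < orient c a q]))%classic.
  by apply/seteqP; split=> q /=; [case|case=> ? [? ?]; split].
by do ?apply: openI; apply: pos.
Qed.

(* Moving from a point of the line ab to its left leaves the right half-plane. *)
Lemma interior_half_plane (S T : set 'rV[R]_2) a b : a != b ->
  (forall q, S q -> orient a b q <= 0) -> (forall q, T q -> 0 <= orient a b q) ->
  (S° `&` T° = set0)%classic.
Proof.
move=> ab S0 T0; apply/seteqP; split=> // q [Sq /interior_subset/T0 q0].
(* [v] is [b - a] turned left by a right angle, so [orient a b] grows along it at rate [c], the
   squared length of [b - a]. *)
pose v : 'rV[R]_2 := \row_j (if j == 0 then a 0 1 - b 0 1 else b 0 0 - a 0 0).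
pose c := (b 0 0 - a 0 0) ^+ 2 + (b 0 1 - a 0 1) ^+ 2.
have c_gt0 : 0 < c.
  rewrite lt_neqAle addr_ge0 ?sqr_ge0 // andbT eq_sym.
  apply: contra ab; rewrite paddr_eq0 ?sqr_ge0 // !sqrf_eq0 !subr_eq0.
  move=> /andP[/eqP e0 /eqP e1]; apply/eqP/rowP => j.
  by have [->|->] : j = 0 \/ j = 1 by case: j => -[|[|//]] ?; [left|right]; apply/val_inj.
have orientE e : orient a b (q + e *: v) = orient a b q + e * c.
  by rewrite /orient !mxE /= /c; ring.
have cvg : ((fun e : R => q + e *: v) @ (0 : R) --> q)%classic.
  have h : ((fun e : R => e *: v) @ (0 : R) --> 0 *: v)%classic.
    by apply: cvgZr_tmp; exact: cvg_id.
  by rewrite -[X in (_ --> X)%classic]addr0 -(scale0r v); apply: cvgD h; exact: cvg_cst.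
have /nbhs_ballP[e /= e0 eS] := cvg _ Sq.
have e2 : 0 < e / 2 by rewrite divr_gt0.
have /S0 : S (q + (e / 2) *: v).
  by apply: eS; rewrite /ball /= sub0r normrN gtr0_norm // ltr_pdivrMr // ltr_pMr // ltr1n.
by rewrite orientE leNgt ltr_wpDl // mulr_gt0.
Qed.

End OrientTopology.

(** * Covering, interiors and edges of inscribed polygons *)

Section ConvexPolygonDissection.
Import mathcomp.boot.fintype mathcomp.boot.finset.
Variables (R : realType) (N : nat) (p : 'I_N -> 'rV[R]_2) (r : 'I_N -> nat) (d : nat).
Hypothesis r_inj : injective r.
Hypothesis convex : forall i j k, (r i < r j < r k)%N -> 0 < orient (p i) (p j) (p k).
Implicit Types (a b i j k u v x y : 'I_N) (A E X Y : {set 'I_N}) (w : 'I_N -> R).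

(* The extra points of E, which lie outside the range [a, b], make the statement
   inductive: the hull is cut along one edge of A at a time. *)
Lemma chain_hull_cover s m a b A D B : chain r d s m a b A D B ->
  forall E q, E \subset outside r a b -> hull p (E :|: itv r a b) q ->
  hull p (E :|: A) q \/ exists2 X, X \in D & hull p X q.
Proof.
have hS := @hullS R N p.
elim=> {s m a b A D B} [s a b ab|s a b A D B ch IH
    |s m a b c A D1 B1 D2 B2 ch1 IH1 ch2 IH2] E q oE hq.
- left; apply: hS hq; apply: setUS; apply/subsetP => i /itv_rank ai.
  rewrite !inE; have [ia|ib] : r i = r a \/ r i = r b by lia.
    by rewrite (r_inj ia) eqxx.
  by rewrite (r_inj ib) eqxx orbT.
- have [ab aA bA _ _] := chain_itv ch.
  have [h|h] := hull_chord convex ab hq.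
    have : hull p (finset.set0 :|: itv r a b) q.
      apply: hS h; apply/subsetP => i; rewrite !inE.
      by case/orP=> [/andP[]//|/orP[]/eqP ->]; lia.
    case/IH; first exact: sub0set.
      by rewrite set0U => hA; right; exists A; rewrite ?inE ?eqxx.
    by case=> X XD hX; right; exists X; rewrite // inE XD orbT.
  left; apply: hS h; apply/subsetP => i; rewrite !inE.
  case/orP=> [/andP[/orP[->//|abi] oi]|->]; last by rewrite orbT.
  have [ia|ib] : r i = r a \/ r i = r b by lia.
    by rewrite (r_inj ia) eqxx orbT.
  by rewrite (r_inj ib) eqxx !orbT.
- have [ac _ _ _ _] := chain_itv ch1; have [cb cA _ _ _] := chain_itv ch2.
  (* For the first edge the range [[c, b]] counts among the extra points; for the remaining edges
     [a] does. *)
  have : hull p ((E :|: itv r c b) :|: itv r a c) q.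
    apply: hS hq; apply/subsetP => i; rewrite !inE.
    by case: (i \in E) => //=; lia.
  case/IH1.
  + rewrite subUset; apply/andP; split; apply/subsetP => i.
      by move/(subsetP oE); rewrite !inE; lia.
    by rewrite !inE; lia.
  + move=> h; have : hull p ((a |: E) :|: itv r c b) q.
      apply: hS h; apply/subsetP => i; rewrite !inE.
      case/orP => [/orP[->|->]|/orP[->|/eqP ->]] //; rewrite ?orbT //.
      by rewrite leqnn ltnW // orbT.
    case/IH2.
    * rewrite subUset sub1set; apply/andP; split; first by rewrite inE; lia.
      by apply/subsetP => i /(subsetP oE); rewrite !inE; lia.
    * by move=> {}h; left; rewrite setUA [E :|: _]setUC.
    * by case=> X XD hX; right; exists X; rewrite // inE XD orbT.
  + by case=> X XD hX; right; exists X; rewrite // inE XD.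
Qed.

Lemma third_vertex X x y : (2 < #|X|)%N -> exists2 z, z \in X & (z != x) && (z != y).
Proof.
move=> X3; have : (0 < #|X :\ x :\ y|)%N.
  move: X3; rewrite (cardsD1 x X) (cardsD1 y (X :\ x)).
  by case: (x \in X); case: (y \in X :\ x) => /=; move: #|_|; clear; lia.
by case/card_gt0P => z; rewrite !inE => /and3P[zy zx zX]; exists z; rewrite // zx zy.
Qed.

Lemma chord_separated_interior X Y : (2 < #|X|)%N -> chord_separated r X Y ->
  ((hull p X)° `&` (hull p Y)° = classical_sets.set0)%classic.
Proof.
move=> X3 [x [y [xy /subsetP sX /subsetP sY]]].
(* A third vertex, strictly between in rank, forces the points [p x] and [p y] to be distinct. *)
have [z zX /andP[zx zy]] := third_vertex x y X3.
apply: (@interior_half_plane _ _ _ (p x) (p y)).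
- have neq u v : u != v -> r u <> r v by move=> /eqP uv /r_inj.
  have := neq _ _ zx; have := neq _ _ zy; have := itv_rank (sX z zX) => zi zny znx.
  have /convex : (r x < r z < r y)%N by lia.
  by apply: contraTneq => ->; rewrite /orient -leNgt; lra.
- move=> q; apply: hull_orient_le0 => i /sX; exact: orient_itv.
- move=> q; apply: hull_orient_ge0 => i /sY; exact: orient_outside.
Qed.

Lemma open_triangle_interior X i j k q : i \in X -> j \in X -> k \in X ->
  i != j -> i != k -> j != k -> 0 < orient (p i) (p j) (p k) ->
  open_triangle (p i) (p j) (p k) q -> ((hull p X)°)%classic q.
Proof.
move=> iX jX kX ij ik jk ijk.
have sub : ([set q | open_triangle (p i) (p j) (p k) q] `<=` hull p X)%classic.
  move=> {}q [q1 q2 q3]; apply: (@hullS _ _ _ [set i; j; k]).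
    by rewrite !subUset !sub1set iX jX kX.
  have qE := barycentric q (lt0r_neq0 ijk).
  have wE := barycentric_weights (p i) (p j) (p k) q.
  have := (divr_gt0 q1 ijk, divr_gt0 q2 ijk, divr_gt0 q3 ijk).
  set ga := orient _ _ q / _; set al := orient _ _ q / _; set be := orient _ _ q / _.
  move=> [[ga0 al0] be0].
  have w1 : al + be + ga = 1 by rewrite -!mulrDl wE divff // lt0r_neq0.
  apply/hullP; exists (fun l => al * (l == i)%:R + be * (l == j)%:R + ga * (l == k)%:R).
    split=> [l|l|]; last by rewrite !big_split /= !sum_delta.
      by rewrite !addr_ge0 // mulr_ge0 ?ler0n // ltW.
    rewrite !inE !negb_or => /andP[/andP[/negPf -> /negPf ->] /negPf ->].
    by rewrite !mulr0 !addr0.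
  under eq_bigr do rewrite !scalerDl.
  by rewrite !big_split /= !sum_delta_scale -qE.
by rewrite (open_subsetE _ (@open_triangle_open _ _ _ _)) in sub; apply: sub.
Qed.

Lemma crossing_interior X Y x1 y1 x2 y2 : (2 < #|X|)%N -> (2 < #|Y|)%N ->
  x1 \in X -> x2 \in X -> y1 \in Y -> y2 \in Y ->
  (r x1 < r y1)%N -> (r y1 < r x2)%N -> (r x2 < r y2)%N ->
  exists q, ((hull p X)° `&` (hull p Y)°)%classic q.
Proof.
(* Completes a chord to a counterclockwise triangle of the polygon, which may require swapping its
   ends. *)
have tri (Z : {set 'I_N}) z1 z2 : (2 < #|Z|)%N -> z1 \in Z -> z2 \in Z -> z1 != z2 ->
    exists u v k, [/\ [/\ u \in Z, v \in Z & k \in Z], [/\ u != v, u != k & v != k],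
      0 < orient (p u) (p v) (p k) &
      (u = z1 /\ v = z2) \/ (u = z2 /\ v = z1)].
  move=> Z3 z1Z z2Z z12; have [z zZ /andP[zz1 zz2]] := third_vertex z1 z2 Z3.
  have o_neq0 : orient (p z1) (p z2) (p z) != 0.
    by apply: (orient_rank_neq0 r_inj convex); rewrite // eq_sym.
  have [gt0|lt0|o0] := ltgtP 0 (orient (p z1) (p z2) (p z)); last first.
  - by rewrite -o0 eqxx in o_neq0.
  - exists z2, z1, z; split=> //; last by right.
      by split; rewrite // eq_sym.
    by rewrite orientN oppr_gt0.
  - exists z1, z2, z; split=> //; last by left.
    by split; rewrite // eq_sym.
move=> X3 Y3 x1X x2X y1Y y2Y x1y1 y1x2 x2y2.
have neq u v : (r u < r v)%N -> u != v by apply: contraTneq => ->; rewrite ltnn.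
have x12 := neq _ _ (ltn_trans x1y1 y1x2); have y12 := neq _ _ (ltn_trans y1x2 x2y2).
have [a [b [c [[aX bX cX] [ab ac bc] abc Eab]]]] := tri X x1 x2 X3 x1X x2X x12.
have [y [z [w [[yY zY wY] [yz yw zw] yzw Eyz]]]] := tri Y y1 y2 Y3 y1Y y2Y y12.
have o1 : 0 < orient (p x1) (p y1) (p x2) by apply: convex; rewrite x1y1.
have o2 : 0 < orient (p y1) (p x2) (p y2) by apply: convex; rewrite y1x2.
have o3 : 0 < orient (p x1) (p x2) (p y2).
  by apply: convex; rewrite (ltn_trans x1y1).
have o4 : 0 < orient (p x1) (p y1) (p y2).
  by apply: convex; rewrite x1y1 (ltn_trans y1x2).
have cross1 : orient (p a) (p b) (p y) * orient (p a) (p b) (p z) < 0.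
  have : orient (p x1) (p x2) (p y1) * orient (p x1) (p x2) (p y2) < 0.
    by rewrite nmulr_rlt0 // orientC orientN oppr_lt0.
  by case: Eab => -[-> ->]; case: Eyz => -[-> ->] //;
    rewrite ?[orient (p x2) _ _]orientN ?mulrNN // mulrC.
have cross2 : orient (p y) (p z) (p a) * orient (p y) (p z) (p b) < 0.
  have : orient (p y1) (p y2) (p x1) * orient (p y1) (p y2) (p x2) < 0.
    rewrite pmulr_rlt0 ?[orient _ _ (p x1)]orientC //.
    by rewrite orientC orientN oppr_lt0.
  by case: Eab => -[-> ->]; case: Eyz => -[-> ->] //;
    rewrite ?[orient (p y2) _ _]orientN ?mulrNN // mulrC.
have [q [qX qY]] := crossing_triangles abc yzw cross1 cross2.
by exists q; split; [apply: (open_triangle_interior aX bX cX)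
  | apply: (open_triangle_interior yY zY wY)].
Qed.

Lemma chord_side_edge X x y : (r x < r y)%N -> x \in X -> y \in X ->
  chord_side r X x y -> [set x; y] \in edges p X.
Proof.
move=> xy xX yX; have x_y : x != y by apply: contraTneq xy => ->; rewrite ltnn.
have neq u v : u != v -> r u <> r v by move=> /eqP uv /r_inj.
(* [edges] takes the ends counterclockwise: [x] before [y] when the other vertices lie outside the
   range, [y] before [x] when they lie inside. *)
case=> [side|/subsetP side]; apply/imsetP; [exists (x, y)|exists (y, x)] => //=; last first.
- by rewrite setUC.
- rewrite inE /= xX yX eq_sym x_y /=; apply/forallP => k; apply/implyP.
  rewrite !inE negb_or => /andP[/andP[/neq ky /neq kx] /side /itv_rank xky].
  by rewrite -orientC; apply: convex; lia.
- rewrite inE /= xX yX x_y /=; apply/forallP => k; apply/implyP.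
  rewrite !inE negb_or => /andP[/andP[/neq kx /neq ky] /side xky].
  have [kx'|ky'] : (r k < r x)%N \/ (r y < r k)%N by lia.
    by rewrite orientC; apply: convex; lia.
  by apply: convex; lia.
Qed.

Lemma share_edge_common X Y : share_edge p X Y ->
  exists x y, [/\ (x != y), x \in X, y \in X, x \in Y & y \in Y].
Proof.
case/set0Pn => e; rewrite inE => /andP[].
move=> /imsetP[[x y]]; rewrite inE /= => /and4P[xX yX xy _] ->.
move=> /imsetP[[x' y']]; rewrite inE /= => /and4P[xY yY _ _] /setP eq_e.
have sub u : u \in [set x; y] -> u \in Y.
  by rewrite eq_e !inE => /orP[]/eqP ->.
by exists x, y; split=> //; apply: sub; rewrite !inE eqxx ?orbT.
Qed.

End ConvexPolygonDissection.

(** * Dissections of the convex polygon *)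

Section Rank.
Variables (N : nat) (e : 'I_N).

(* The rank of a vertex, counted from the far end [ordS e] of the marked edge. *)
Definition rank (i : 'I_N) : nat := if (i <= e)%N then (i + (N.-1 - e))%N else (i - e.+1)%N.

Lemma rank_inj : injective rank.
Proof.
move=> i j; rewrite /rank => ij; apply: val_inj => /=; move: ij.
have := ltn_ord i; have := ltn_ord j; have := ltn_ord e.
by case: (leqP i e) => ie; case: (leqP j e) => je; lia.
Qed.

Lemma rank_lt i : (rank i < N)%N.
Proof. by rewrite /rank; have := ltn_ord i; have := ltn_ord e; case: (leqP i e); lia. Qed.

Lemma rank_onto (b : 'I_N) m : (m <= rank b)%N -> exists i, rank i = m.
Proof.
move=> mb; have mN : (m < N)%N := leq_ltn_trans mb (rank_lt b).
have := ltn_ord e => eN.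
have [le|lt] := leqP (N.-1 - e) m.
  have iN : (m - (N.-1 - e) < N)%N by lia.
  by exists (Ordinal iN); rewrite /rank /=; case: leqP; lia.
have iN : (m + e.+1 < N)%N by lia.
by exists (Ordinal iN); rewrite /rank /=; case: leqP; lia.
Qed.

Lemma rank_last : rank e = N.-1.
Proof. by rewrite /rank leqnn; have := ltn_ord e; lia. Qed.

Lemma rank_first : rank (ordS e) = 0%N.
Proof.
have eN := ltn_ord e; rewrite /rank /=.
have [eN1|] := ltnP e.+1 N.
  by rewrite modn_small //; case: leqP; lia.
move=> Ne; have -> : e.+1 = N by lia.
by rewrite modnn /=; lia.
Qed.

(** [rank] is a rotation of the indices, so it preserves the cyclic order of triples, and [orient]
    is invariant under cyclic permutations. *)
Lemma rank_convex (R : realType) (p : 'I_N -> 'rV[R]_2) : strictly_convex p ->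
  forall i j k, (rank i < rank j < rank k)%N -> 0 < orient (p i) (p j) (p k).
Proof.
move=> cvx i j k; rewrite /rank => ijk.
have : [|| i < j < k, j < k < i | k < i < j]%N.
  move: ijk; have := ltn_ord i; have := ltn_ord j; have := ltn_ord k; have := ltn_ord e.
  by case: (leqP i e) => ?; case: (leqP j e) => ?; case: (leqP k e) => ?; lia.
case/or3P => /cvx //; first by rewrite orientC.
by rewrite -orientC.
Qed.

End Rank.

Section Dissections.
Import mathcomp.boot.fintype mathcomp.boot.finset.
Variables (R : realType) (d n : nat).
Hypothesis d_ge2 : (2 <= d)%N.
Hypothesis n_gt0 : (0 < n)%N.
Variables (p : 'I_(d.-1 * n).+2 -> 'rV[R]_2) (e : 'I_(d.-1 * n).+2).
Hypothesis cvx : strictly_convex p.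
Local Notation chain s D B := (chain (rank e) d s 1 (ordS e) e [set ordS e; e] D B).
Local Notation r_inj := (@rank_inj _ e).
Local Notation r_onto := (@rank_onto _ e).
Let r_convex := rank_convex (e := e) cvx.

Lemma rank_itvT : itv (rank e) (ordS e) e = [set: _].
Proof.
apply/setP => i; rewrite !inE rank_first rank_last /=.
by have := rank_lt e i.
Qed.

Lemma chain_dissection D B : chain true D B -> dissection p d n D.
Proof.
move=> ch; split.
- have := chain_card r_inj d_ge2 ch; rewrite rank_first rank_last subn0 /=.
  rewrite addn1 => /eqP; rewrite eqSS eqn_pmul2l => [/eqP //|].
  by move: d_ge2; clear; lia.
- by move=> A /(chain_pieces ch)[].
- move=> X Y XD YD XY.
  have [cX _ _] := chain_pieces ch XD; have [cY _ _] := chain_pieces ch YD.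
  have [sep|sep] := chain_chord_separated ch XD YD XY.
    by apply: (chord_separated_interior r_inj r_convex _ sep); rewrite cX.
  rewrite classical_sets.setIC.
  by apply: (chord_separated_interior r_inj r_convex _ sep); rewrite cY.
- apply/seteqP; split=> q.
    by case=> X _; apply: hullS; apply: subsetT.
  have [_] := chain1_inv ch; case=> [[]|[A [D' [B' [chA eD _]]]]].
    rewrite rank_first rank_last /= => [[]] /eqP; rewrite muln_eq0.
    by move: d_ge2 n_gt0; clear; lia.
  move=> hq; have : hull p (finset.set0 :|: itv (rank e) (ordS e) e) q.
    by rewrite rank_itvT set0U.
  move/(chain_hull_cover r_inj r_convex chA); case; first exact: sub0set.
    by rewrite set0U => hA; exists A => //=; rewrite eD !inE eqxx.
  by case=> X XD hX; exists X => //=; rewrite eD !inE XD orbT.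
Qed.

Lemma dissection_chainE D s : dissection p d n D -> exists B, chain s D B.
Proof.
move=> [cD szD intD _].
have d1 : (0 < d.-1)%N by move: d_ge2; clear; lia.
have famD : polygon_family (rank e) d D.
  split=> // X Y x1 y1 x2 y2 XD YD XY x1X x2X y1Y y2Y; apply/and3P => -[h1 h2 h3].
  have [||q] := crossing_interior r_inj r_convex (X := X) (Y := Y) _ _ x1X x2X y1Y y2Y h1 h2 h3.
  - by rewrite szD.
  - by rewrite szD.
  - by rewrite intD.
have [||X _|_] := polygon_family_tight r_inj r_onto d_ge2 (m := (d.-1 * n).+1)
    (a := ordS e) (b := e) _ _ famD.
- by rewrite rank_first rank_last.
- by rewrite rank_first rank_last.
- by rewrite rank_itvT subsetT.
by apply; rewrite cD rank_first rank_last subn0 addn1.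
Qed.

Lemma chain_checkerboard D B : chain true D B -> checkerboard p e D B.
Proof.
move=> ch; have [e_neq _ _ _ _] := chain_itv ch.
have ee : ordS e != e by apply: contraTneq e_neq => ->; rewrite ltnn.
apply/and3P; split; first exact: chain_blacks_sub ch.
- apply/forall_inP => X XD; apply/implyP; rewrite subUset !sub1set => /andP[eX e'X].
  by rewrite (chain_colour_root r_inj d_ge2 ch XD ee e'X eX) // !inE eqxx ?orbT.
- apply/forall_inP => X XD; apply/forall_inP => Y YD; apply/implyP => /andP[XY].
  move=> /share_edge_common[x [y [xy xX yX xY yY]]].
  exact: (chain_colour_adjacent r_inj d_ge2 ch XD YD XY xy xX yX xY yY).
Qed.

Lemma chain_checkerboard_unique D B C : chain true D B -> checkerboard p e D C -> C = B.
Proof.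
move=> ch /and3P[CD /forall_inP rootC /forall_inP adjC]; apply/setP => X.
case: (boolP (X \in D)) => XD; last first.
  rewrite (contraNF (subsetP CD X)) // (contraNF (subsetP (chain_blacks_sub ch) X)) //.
apply: (chain_colour_unique r_inj d_ge2 ch) XD
  => [Y x y YD xy xY yY xe ye|Y Z x y YD ZD YZ xy xY yY xZ yZ sY sZ].
- apply: (implyP (rootC Y YD)); rewrite subUset !sub1set.
  by move: xe ye xy xY yY; rewrite !inE => /orP[]/eqP -> /orP[]/eqP ->;
    rewrite ?eqxx // => _ -> ->.
- apply: (implyP (forall_inP (adjC Y YD) Z ZD)); rewrite YZ.
  by apply/set0Pn; exists [set x; y]; rewrite inE !(chord_side_edge r_inj r_convex).
Qed.

Lemma chain_blacks D B : chain true D B -> blacks p e D = B.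
Proof.
move=> ch; rewrite /blacks; case: pickP => [C /(chain_checkerboard_unique ch) //|].
by move/(_ B); rewrite chain_checkerboard.
Qed.

Definition tile_weight (s : bool) : laurent := if s then laurentX else laurentX^-1.

Lemma colour_weightE (D B : {set {set 'I_(d.-1 * n).+2}}) : B \subset D ->
  colour_weight tile_weight D B = laurentX ^ (#|B|%:Z - #|D :\: B|%:Z).
Proof.
move=> BD; rewrite /colour_weight (big_setID B) /= (setIidPr BD).
rewrite exprzDr ?laurentX_unit // -exprnN -exprVn -exprnP -!prodr_const.
congr (_ * _); apply: eq_bigr => X; first by move=> ->.
by rewrite inE => /andP[/negPf ->].
Qed.

(** A dissection determines its coloured chain: the vertex set is the marked edge and [B] is
    [blacks p e D]. Hence keeping only [D] is injective on chains, and the sum can be reindexed. *)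
Lemma w_poly_chain_sum :
  w_poly d n p e = chain_sum (rank e) d tile_weight true 1 (ordS e) e.
Proof.
rewrite /w_poly (gtn_eqF n_gt0) /chain_sum.
have weightE (D B : {set {set 'I_(d.-1 * n).+2}}) : chain true D B ->
    dissection_weight p e D = colour_weight tile_weight D B.
  move=> ch; rewrite /dissection_weight (chain_blacks ch).
  by rewrite (colour_weightE (chain_blacks_sub ch)).
rewrite (eq_bigl (mem [set T.1.2 | T in chains (rank e) d true 1 (ordS e) e])) => [|D].
  rewrite big_imset /= => [|[[A D] B] [[A' D'] B'] /chainsP/= ch /chainsP/= ch' eD].
    apply: eq_bigr => -[[A D] B] /chainsP/= ch; have [eA _] := chain1_inv ch.
    by apply: weightE; rewrite -eA.
  have [eA _] := chain1_inv ch; have [eA' _] := chain1_inv ch'; subst A A' D'.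
  by rewrite -(chain_blacks ch) (chain_blacks ch').
apply/asboolP/imsetP => [|[[[A D'] B] /chainsP/= ch ->]].
  by case/(dissection_chainE true) => B ch; exists ([set ordS e; e], D, B) => //; apply/chainsP.
by have [eA _] := chain1_inv ch; rewrite eA in ch; apply: chain_dissection ch.
Qed.

End Dissections.

Theorem theorem3p2 (R : realType) (d : nat) (hd : (2 <= d)%N)
  (p : forall n : nat, 'I_(d.-1 * n).+2 -> 'rV[R]_2)
  (hp : forall n : nat, strictly_convex (p n))
  (e : forall n : nat, 'I_(d.-1 * n).+2) :
  let W : fps laurent := Fps (fun n => w_poly d n (p n) (e n)) in
  let t : laurent := laurentX in
  W = 1 + fpsC t * fpsX * (1 + fpsC t^-1 * fpsX * W ^+ d) ^+ d.
Proof.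
move=> W t.
have -> : W = dissection_series d tile_weight true.
  apply: fpsP => n; rewrite /= -[RHS]/(fcoef (dissection_series d tile_weight true ^+ 1) n).
  have rank_e : rank (e n) (e n) = (rank (e n) (ordS (e n)) + (d.-1 * n + 1))%N.
    by rewrite rank_first rank_last addn1.
  rewrite -(chain_sum_series hd tile_weight true (@rank_inj _ _) (@rank_onto _ _) rank_e).
  (* For [n = 0] the conventional value 1 is the weight of the empty family on a single unit
     edge. *)
  case: n rank_e => [|n] rank_e; last exact: w_poly_chain_sum.
  by rewrite (chain_sum_edge (@rank_inj _ _) hd) // rank_first rank_last /= muln0.
have eq1 := dissection_series_eq hd tile_weight true.
have eq0 := dissection_series_eq hd tile_weight false.
by rewrite {1}eq1 /= {1}eq0.
Qed.
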